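(* Let $\Lambda$ be a closed subset of $\mathbb{S}^n$ and assume there is a uniformly distributed set $X$ of bounded type in the convex hull $H(\Lambda)$. Then the $\Delta(X)$-dimensional Hausdorff measure of $\Lambda$ is positive. In particular, the box-counting dimension of $\Lambda$ exists and $$\dim_H(\Lambda)=h_c(\Lambda)=\dim_B(\Lambda).$$
   Context: Let $n\ge1$. $(\mathbb{B}^{n+1},d)$ is the unit ball model of hyperbolic space with origin $o$ and boundary at infinity $\mathbb{S}^n$; $B_R(z)$ is the hyperbolic ball of centre $z$ and radius $R$, $\mathrm{vol}$ is hyperbolic volume, $\#$ is cardinality. For a closed $\Lambda\subset\mathbb{S}^n$, the convex hull $H(\Lambda)\subset\mathbb{B}^{n+1}$ is the hyperbolic convex hull of the union of all geodesics with both end points in $\Lambda$, and $H_\varepsilon(\Lambda)$ is its $\varepsilon$-neighbourhood. The convex core entropy is $h_c(\Lambda)=\limsup_{R\to\infty}\frac1R\log\mathrm{vol}(B_R(z)\cap H_\varepsilon(\Lambda))$ (independent of $z\in\mathbb{B}^{n+1}$ and $\varepsilon>0$). A discrete set $X\subset H(\Lambda)$ is uniformly distributed if (i) there is $M<\infty$ such that every $z\in H(\Lambda)$ has some $x\in X$ with $d(x,z)\le M$, and (ii) there is $m>0$ with $d(x,x')\ge m$ for all distinct $x,x'\in X$. Its critical exponent is $\Delta(X)=\inf\{s>0:\sum_{x\in X}e^{-s\,d(x,z)}<\infty\}$, for any $z\in\mathbb{B}^{n+1}$. $X$ is of bounded type if, assuming $o\in X$, there is a constant $\rho\ge1$ such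 that $$\frac{\#(X\cap B_R(x))}{\#(X\cap B_R(o))}\le\rho\qquad\text{for all }x\in X,\ R>0.$$ $\dim_H$ and $\dim_B$ denote Hausdorff dimension and box-counting dimension (the common value of upper and lower box-counting dimension) with respect to the spherical metric on $\mathbb{S}^n$. *)

(* Defs.v *)
From HB Require Import structures.
From mathcomp Require Import all_boot all_order all_algebra.
From mathcomp Require Import all_classical all_reals all_analysis.

Set Implicit Arguments.
Unset Strict Implicit.
Unset Printing Implicit Defensive.

Import Order.TTheory GRing.Theory Num.Theory.
Import numFieldNormedType.Exports.

Local Open Scope classical_set_scope.
Local Open Scope ring_scope.

Section Euclidean.
Context {R : realType} {k : nat}.
Implicit Types x y : 'rV[R]_k.

Definition dotv x y : R := \sum_(i < k) x 0 i * y 0 i.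

(* The norm `|x| of MathComp-Analysis on matrices is the sup norm, hence the
   separate squared Euclidean norm; both norms define the same topology. *)
Definition sqnorm x : R := dotv x x.

Definition unit_ball : set 'rV[R]_k := [set x | sqnorm x < 1].

Definition unit_sphere : set 'rV[R]_k := [set x | sqnorm x = 1].

End Euclidean.

(* k-dimensional Lebesgue measure, the k-fold product of lebesgue_measure. *)
Fixpoint lebesgue_tuple (R : realType) (k : nat) :
    set (k.-tuple (measurableTypeR R)) -> \bar R :=
  match k with
  | 0 => dirac [tuple]
  | k'.+1 => pushforward
      (product_measure1 (@lebesgue_measure R) (@lebesgue_tuple R k'))
      (fun p : measurableTypeR R * k'.-tuple (measurableTypeR R) =>
         [the k'.+1.-tuple (measurableTypeR R) of p.1 :: p.2])
  end.

Section Hyperbolic.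
Context {R : realType} {k : nat}.
Implicit Types (x y z : 'rV[R]_k) (A C X Lambda : set 'rV[R]_k).

Definition arcosh (t : R) : R := ln (t + Num.sqrt (t ^+ 2 - 1)).

(* Distance of the ball model of curvature -1; only meaningful on unit_ball. *)
Definition hdist x y : R :=
  arcosh (1 + 2 * sqnorm (x - y) / ((1 - sqnorm x) * (1 - sqnorm y))).

Definition hball z (r : R) : set 'rV[R]_k :=
  [set x | unit_ball x /\ hdist x z < r].

Definition hneighborhood A (eps : R) : set 'rV[R]_k :=
  [set x | unit_ball x /\ exists2 y, A y & hdist x y < eps].

Definition row_of_tuple (t : k.-tuple (measurableTypeR R)) : 'rV[R]_k :=
  \row_i tnth t i.

(* Volume form of the metric 4 |dx|^2 / (1 - |x|^2)^2. *)
Definition hvol A : \bar R :=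
  (\int[@lebesgue_tuple R k]_(t in row_of_tuple @^-1` A)
     ((2 / (1 - sqnorm (row_of_tuple t))) ^+ k)%:E)%E.

Definition geodesic_on (I : set R) (g : R -> 'rV[R]_k) : Prop :=
  (forall t, I t -> unit_ball (g t)) /\
  (forall s t, I s -> I t -> hdist (g s) (g t) = `|s - t|).

Definition hconvex C : Prop :=
  C `<=` unit_ball /\
  forall (a b : R) (g : R -> 'rV[R]_k), a <= b ->
    geodesic_on `[a, b] g -> C (g a) -> C (g b) -> g @` `[a, b] `<=` C.

Definition geodesics_between Lambda : set 'rV[R]_k :=
  [set x | exists g : R -> 'rV[R]_k, exists u v : 'rV[R]_k,
     [/\ geodesic_on setT g, Lambda u /\ Lambda v,
         g t @[t --> -oo] --> u, g t @[t --> +oo] --> v & range g x]].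

Definition hhull Lambda : set 'rV[R]_k :=
  smallest hconvex (geodesics_between Lambda).

Definition convex_core_entropy Lambda z (eps : R) : \bar R :=
  limf_esup (fun r : R =>
    (r^-1)%:E * lne (hvol (hball z r `&` hneighborhood (hhull Lambda) eps)))%E
    (pinfty_nbhs R).

(* The separation condition makes X discrete. *)
Definition uniformly_distributed A X : Prop :=
  [/\ X `<=` A,
      exists M : R, forall z, A z -> exists2 x, X x & hdist x z <= M
    & exists2 m : R, 0 < m &
        forall x y, X x -> X y -> x <> y -> m <= hdist x y].

(* If no s is admissible, inf is 0; this does not happen for uniformly
   distributed X, whose series converges for every s > k - 1. *)
Definition critical_exponent X z : R :=
  inf [set s : R | 0 < s /\
    (\esum_(x in X) (expR (- (s * hdist x z)))%:E < +oo)%E].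

(* The origin is usually assumed to lie in X and taken as x0; any other point
   of X is allowed here, so that X need not contain the origin. *)
Definition bounded_type X : Prop :=
  exists2 x0, X x0 & exists2 rho : R, 1 <= rho &
    forall x (r : R), X x -> 0 < r ->
      (counting (X `&` hball x r) <=
         rho%:E * counting (X `&` hball x0 r))%E.

End Hyperbolic.

Section SphericalDimensions.
Context {R : realType} {k : nat}.
Implicit Types (A U : set 'rV[R]_k).

(* Angular distance; only meaningful on unit_sphere. *)
Definition sdist (x y : 'rV[R]_k) : R := acos (dotv x y).

Definition sdiam U : \bar R :=
  ereal_sup [set (sdist p.1 p.2)%:E | p in U `*` U].

(* Convention: 0 for the empty set, and 0 `^ 0 = 1 for a point when s = 0. *)
Definition diam_pow (s : R) U : \bar R :=
  if U == set0 then 0%E else poweR (sdiam U) s.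

Definition delta_cover (delta : R) A : set (nat -> set 'rV[R]_k) :=
  [set U | (forall i, U i `<=` unit_sphere /\ (sdiam (U i) <= delta%:E)%E) /\
           A `<=` \bigcup_i U i].

Definition hausdorff_premeasure (s delta : R) A : \bar R :=
  ereal_inf [set (\sum_(0 <= i <oo) diam_pow s (U i))%E |
             U in delta_cover delta A].

Definition hausdorff_measure (s : R) A : \bar R :=
  ereal_sup [set hausdorff_premeasure s delta A |
             delta in [set delta : R | 0 < delta]].

Definition hausdorff_dim A : \bar R :=
  ereal_inf [set s%:E | s in
    [set s : R | 0 <= s /\ hausdorff_measure s A = 0%E]].

Definition covering_number (delta : R) A : \bar R :=
  ereal_inf [set N%:R%:E | N in [set N : nat |
    exists U : nat -> set 'rV[R]_k,
      (forall i, U i `<=` unit_sphere /\ (sdiam (U i) <= delta%:E)%E) /\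
      A `<=` \bigcup_(i < N) U i]].

Definition box_ratio A (delta : R) : \bar R :=
  (lne (covering_number delta A) * ((- ln delta)^-1)%:E)%E.

Definition upper_box_dim A : \bar R := limf_esup (box_ratio A) (at_right 0).

Definition lower_box_dim A : \bar R := limf_einf (box_ratio A) (at_right 0).

End SphericalDimensions.

(* Main.v *)
Require Import Defs.
From HB Require Import structures.
From mathcomp Require Import all_boot all_order all_algebra.
From mathcomp Require Import all_classical all_reals all_analysis measurable_realfun.
From mathcomp Require Import finmap ring lra.
Set Implicit Arguments.
Unset Strict Implicit.
Unset Printing Implicit Defensive.
Import Order.TTheory GRing.Theory Num.Theory.
Import numFieldNormedType.Exports.
Local Open Scope classical_set_scope.
Local Open Scope ring_scope.

(* All the quantities are compared in the chain Delta(X) <= dim_H <= lower box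
   dimension <= upper box dimension <= h_c <= Delta(X).

   In the hyperboloid model a geodesic segment is a nonnegative combination of
   its end points, so half-spaces are convex.  Hence a point x of the hull at
   distance d from o has a point of Lambda within O(e^-d) of its radial
   projection, while conversely each ray from o to Lambda stays at bounded
   distance from the hull, hence from X.  Covering Lambda by the shadows of the
   points of X at distance about - ln delta bounds the covering number, and
   comparing balls centred at X with Euclidean cubes of side proportional to
   1 - |x|^2 turns cardinalities into volumes: this gives the last two
   inequalities.

   For the first one, let N(r) be the number of points of X in the ball of
   radius r and let Lambda be covered by finitely many balls of radii r_i.  A
   point of X far away has its shadow in one of them, and is then seen from a
   point of X near the top of that shadow at a distance shortened by - ln r_i;
   so bounded type gives N(r) <= A + rho * sum_i N(r + ln r_i + D).  If
   sum_i r_i^Delta were small, the same sum would be small for some exponent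
   sigma < Delta, and iterating the inequality would give N(r) = O(e^(sigma r)),
   contradicting the definition of Delta(X). *)

(** * Euclidean products *)

Section Dot.
Context {R : realType} {k : nat}.
Implicit Types x y z : 'rV[R]_k.

Lemma dotvC x y : dotv x y = dotv y x.
Proof. by apply: eq_bigr => i _; rewrite mulrC. Qed.

Lemma dotvDl x y z : dotv (x + y) z = dotv x z + dotv y z.
Proof. by rewrite /dotv -big_split; apply: eq_bigr => i _; rewrite mxE mulrDl. Qed.

Lemma dotvZl (a : R) x y : dotv (a *: x) y = a * dotv x y.
Proof. by rewrite /dotv mulr_sumr; apply: eq_bigr => i _; rewrite mxE mulrA. Qed.

Lemma dotvNl x y : dotv (- x) y = - dotv x y.
Proof. by rewrite -scaleN1r dotvZl mulN1r. Qed.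

Lemma dotvDr x y z : dotv z (x + y) = dotv z x + dotv z y.
Proof. by rewrite dotvC dotvDl !(dotvC z). Qed.

Lemma dotvZr (a : R) x y : dotv x (a *: y) = a * dotv x y.
Proof. by rewrite dotvC dotvZl (dotvC x). Qed.

Lemma dotvNr x y : dotv x (- y) = - dotv x y.
Proof. by rewrite dotvC dotvNl (dotvC x). Qed.

Lemma dot0v x : dotv 0 x = 0.
Proof. by rewrite -(scale0r x) dotvZl mul0r. Qed.

Definition dotvE := (dotvDl, dotvDr, dotvZl, dotvZr, dotvNl, dotvNr).

Lemma sqnorm_ge0 x : 0 <= sqnorm x.
Proof. by apply: sumr_ge0 => i _; rewrite -expr2 sqr_ge0. Qed.

Lemma sqnorm0_eq0 x : sqnorm x = 0 -> x = 0.
Proof.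
move=> /eqP; rewrite psumr_eq0 => [/allP H|i _]; last by rewrite -expr2 sqr_ge0.
apply/rowP => i; rewrite mxE; apply/eqP.
by have := H i (mem_index_enum i); rewrite -expr2 sqrf_eq0.
Qed.

Lemma sqnormD x y : sqnorm (x + y) = sqnorm x + sqnorm y + 2 * dotv x y.
Proof. by rewrite /sqnorm !dotvE (dotvC y x); ring. Qed.

Lemma sqnormB x y : sqnorm (x - y) = sqnorm x + sqnorm y - 2 * dotv x y.
Proof. by rewrite /sqnorm !dotvE (dotvC y x); ring. Qed.

Lemma sqnormZ (a : R) x : sqnorm (a *: x) = a ^+ 2 * sqnorm x.
Proof. by rewrite /sqnorm !dotvE; ring. Qed.

Lemma sqnormN x : sqnorm (- x) = sqnorm x.
Proof. by rewrite /sqnorm !dotvE; ring. Qed.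

(** A nonnegative quadratic polynomial has nonpositive discriminant. Only real coefficients appear,
    so that the Euclidean and the Lorentz form can share it. *)
Lemma psd_cauchy_schwarz (a b c : R) :
  (forall t, 0 <= a + 2 * t * b + t ^+ 2 * c) -> b ^+ 2 <= a * c.
Proof.
move=> H; have [c0|c0|c0] := ltgtP c 0.
- exfalso; have a0 := H 0; have := H ((1 + a + `|b|) / c * (-2)).
  have := H ((1 + a + `|b|) / c * 2).
  have ic : c^-1 < 0 by rewrite invr_lt0.
  have cc : c * c^-1 = 1 by rewrite mulfV // lt_eqF.
  set t := (1 + a + `|b|) / c => H1 H2.
  have tc : t * c = 1 + a + `|b| by rewrite /t mulrVK // unitfE lt_eqF.
  have bn := normr_ge0 b.
  have t0 : t < 0 by rewrite /t pmulr_rlt0 //; nra.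
  have {H1 H2} : 0 <= 2 * a + 8 * t * (t * c) by nra.
  rewrite tc; have := H (1 : R); have := H (-1 : R) => H3 H4.
  have := ler_norm b; have := lerNnormlW (lexx `|b|) => h1 h2 h3.
  have {H3 H4}: 0 <= a + c by nra.
  move=> ac.
  have tt : t <= -1.
    have: t * c >= - c by rewrite tc; lra.
    by move=> tc1; nra.
  nra.
- have H1 := H (- b / c).
  have := mulr_ge0 (ltW c0) H1.
  suff -> : c * (a + 2 * (- b / c) * b + (- b / c) ^+ 2 * c) = a * c - b ^+ 2.
    by rewrite subr_ge0.
  by field; rewrite gt_eqF.
- have [->|b0] := eqVneq b 0; first by rewrite c0; lra.
  have := H (- (a + 1) / (2 * b)).
  suff -> : a + 2 * (- (a + 1) / (2 * b)) * b + (- (a + 1) / (2 * b)) ^+ 2 * c = -1.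
    by rewrite ler0N1.
  by rewrite c0; field.
Qed.

Lemma cauchy_schwarz x y : dotv x y ^+ 2 <= sqnorm x * sqnorm y.
Proof.
apply: psd_cauchy_schwarz => t.
have := sqnorm_ge0 (x + t *: y); rewrite sqnormD sqnormZ dotvZr; congr (_ <= _); ring.
Qed.

Lemma sqnorm_coord x i : (x 0 i) ^+ 2 <= sqnorm x.
Proof.
rewrite /sqnorm /dotv (bigD1 i) //= -expr2 lerDl.
by apply: sumr_ge0 => j _; rewrite -expr2 sqr_ge0.
Qed.

Lemma sqnorm_le_coord x (a : R) :
  (forall i, `|x 0 i| <= a) -> sqnorm x <= k%:R * a ^+ 2.
Proof.
move=> H; rewrite /sqnorm /dotv.
apply: (le_trans (y := \sum_(i < k) a ^+ 2)).
  apply: ler_sum => i _; rewrite -expr2 -real_normK ?num_real //.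
  by rewrite lerXn2r // ?nnegrE // (le_trans _ (H i)).
by rewrite sumr_const card_ord mulr_natl.
Qed.

End Dot.

(** * The hyperboloid model *)

Section Cosh.
Context {R : realType}.
Implicit Types a b c t : R.

Definition cosh t : R := (expR t + expR (- t)) / 2.
Definition sinh t : R := (expR t - expR (- t)) / 2.

Lemma expR_mulN t : expR t * expR (- t) = 1.
Proof. by rewrite -expRD subrr expR0. Qed.

Lemma sqr_sinh t : sinh t ^+ 2 = cosh t ^+ 2 - 1.
Proof. by rewrite /sinh /cosh; have := expR_mulN t; move: (expR t) (expR _) => u v h; field: h. Qed.

Lemma coshN t : cosh (- t) = cosh t.
Proof. by rewrite /cosh opprK addrC. Qed.

Lemma cosh_abs t : cosh `|t| = cosh t.
Proof. by case: (ger0P t) => //; rewrite coshN. Qed.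

Lemma cosh_ge1 t : 1 <= cosh t.
Proof.
rewrite /cosh; have := expR_mulN t; have := expR_gt0 t; have := expR_gt0 (- t).
move: (expR t) (expR _) => u v v0 u0 uv.
have : 0 <= v * (u - 1) ^+ 2 by rewrite mulr_ge0 ?sqr_ge0 // ltW.
have -> : v * (u - 1) ^+ 2 = u * (u * v) - 2 * (u * v) + v by ring.
rewrite uv; lra.
Qed.

Lemma sinh_ge0 t : 0 <= t -> 0 <= sinh t.
Proof. by move=> t0; rewrite /sinh divr_ge0 // subr_ge0 ler_expR; lra. Qed.

Lemma sinh_gt0 t : 0 < t -> 0 < sinh t.
Proof. by move=> t0; rewrite /sinh divr_gt0 // subr_gt0 ltr_expR; lra. Qed.

Lemma coshD a b : cosh (a + b) = cosh a * cosh b + sinh a * sinh b.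
Proof. by rewrite /cosh /sinh opprD !expRD; field. Qed.

Lemma ltr_cosh a b : 0 <= a -> a < b -> cosh a < cosh b.
Proof.
move=> a0 ab; have -> : b = a + (b - a) by ring.
rewrite coshD; have s1 := sinh_ge0 a0.
have d0 : 0 < b - a by lra.
have s2 := sinh_gt0 d0.
have c1 := cosh_ge1 a; have c2 : 1 < cosh (b - a).
  have := sqr_sinh (b - a); have := cosh_ge1 (b - a); nra.
nra.
Qed.

Lemma ler_cosh a b : 0 <= a -> 0 <= b -> (cosh a <= cosh b) = (a <= b).
Proof.
move=> a0 b0; apply/idP/idP; first by apply: contraTT; rewrite -!ltNge; exact: ltr_cosh.
by rewrite le_eqVlt => /predU1P[->//|/(ltr_cosh a0)/ltW].
Qed.

Lemma ltr_cosh_mono a b : 0 <= a -> 0 <= b -> (cosh a < cosh b) = (a < b).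
Proof. by move=> a0 b0; rewrite !ltNge ler_cosh. Qed.

Lemma cosh_le_exp t : 0 <= t -> cosh t <= expR t.
Proof.
move=> t0; rewrite /cosh; have : expR (- t) <= expR t by rewrite ler_expR; lra.
lra.
Qed.

Lemma exp_le_cosh t : expR t <= 2 * cosh t.
Proof. by rewrite /cosh; have := expR_gt0 (- t); lra. Qed.

Lemma arcosh_arg_ge1 c : 1 <= c -> 1 <= c + Num.sqrt (c ^+ 2 - 1).
Proof. by move=> c1; have := sqrtr_ge0 (c ^+ 2 - 1); lra. Qed.

Lemma arcosh_ge0 c : 1 <= c -> 0 <= arcosh c.
Proof. by move=> c1; rewrite /arcosh ln_ge0 // arcosh_arg_ge1. Qed.

Lemma arcoshK c : 1 <= c -> cosh (arcosh c) = c.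
Proof.
move=> c1; have h := arcosh_arg_ge1 c1; rewrite /cosh expRN /arcosh lnK; last first.
  by rewrite posrE; lra.
have e : Num.sqrt (c ^+ 2 - 1) ^+ 2 = c ^+ 2 - 1 by rewrite sqr_sqrtr //; nra.
move: (Num.sqrt _) h e => s h e.
have u0 : c + s != 0 by rewrite gt_eqF //; lra.
by have -> : (c + s)^-1 = c - s; [apply: (mulIf u0); rewrite mulVf //; nra|field].
Qed.

Lemma cosh_inj : {in Num.nneg &, injective cosh}.
Proof. by move=> a b; rewrite !nnegrE => a0 b0 /eqP; rewrite eq_le !ler_cosh // -eq_le => /eqP. Qed.

Lemma coshK t : 0 <= t -> arcosh (cosh t) = t.
Proof.
by move=> t0; apply: cosh_inj; rewrite ?nnegrE ?arcosh_ge0 ?arcoshK ?cosh_ge1.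
Qed.

End Cosh.

Section Hyperboloid.
Context {R : realType} {k : nat}.
Implicit Types (x y z : 'rV[R]_k).

(* Lorentz form on [R * 'rV_k], written on components. *)
Definition lor (a : R) x (b : R) y : R := a * b - dotv x y.

(** The expression is minus the Lorentz square of the component of [(a, x)] orthogonal to the
    timelike unit vector [(b, y)], and the form is negative definite on that orthogonal
    complement. *)
Lemma lor_psd (b : R) y (a : R) x : lor b y b y = 1 ->
  0 <= lor a x b y ^+ 2 - lor a x a x.
Proof.
rewrite /lor -/(sqnorm _) -/(sqnorm _) => yy.
have := cauchy_schwarz x y; have := sqnorm_ge0 x; have := sqnorm_ge0 y.
move: (sqnorm x) (sqnorm y) (dotv x y) yy => m n p yy n0 m0 cs.
have [n_gt0|n_le0] := ltP 0 n.
- rewrite -(pmulr_rge0 _ n_gt0).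
  have : 0 <= (a * n - b * p) ^+ 2 by rewrite sqr_ge0.
  have -> : (a * n - b * p) ^+ 2 = a ^+ 2 * n ^+ 2 - 2 * a * b * p * n + (n + 1) * p ^+ 2.
    have -> : n = b * b - 1 by rewrite -yy; ring.
    ring.
  have -> : n * ((a * b - p) ^+ 2 - (a * a - m)) =
     a ^+ 2 * n * (b * b - 1) - 2 * a * b * p * n + n * p ^+ 2 + n * m by ring.
  have -> : b * b - 1 = n by rewrite -yy; ring.
  nra.
- have nE : n = 0 by lra.
  have pE : p = 0 by apply/eqP; rewrite -sqrf_eq0 eq_le sqr_ge0 andbT; move: cs; rewrite nE mulr0.
  rewrite pE; have : b * b = 1 by lra.
  move=> bb; have -> : (a * b - 0) ^+ 2 - (a * a - m) = m + a * a * (b * b - 1) by ring.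
  by rewrite bb subrr mulr0 addr0.
Qed.

(** Cauchy-Schwarz for the semidefinite form of [lor_psd]. On three points of the hyperboloid it
    compares [cosh] of one distance with the other two. *)
Lemma lor_cauchy_schwarz (b : R) y (a : R) x (c : R) z : lor b y b y = 1 ->
  (lor a x b y * lor c z b y - lor a x c z) ^+ 2 <=
  (lor a x b y ^+ 2 - lor a x a x) * (lor c z b y ^+ 2 - lor c z c z).
Proof.
move=> yy; apply: psd_cauchy_schwarz => t.
have := @lor_psd b y (a + t * c) (x + t *: z) yy; congr (_ <= _).
by rewrite /lor !dotvE (dotvC z x); ring.
Qed.

(** Orthogonality to a timelike unit vector forces a vector to be spacelike or zero, so a null one
    vanishes; this is how equalities between lifts are obtained. *)
Lemma lor_null (b : R) y (a : R) x : lor b y b y = 1 ->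
  lor a x b y = 0 -> lor a x a x = 0 -> a = 0 /\ x = 0.
Proof.
rewrite /lor => yy xy xx.
have := cauchy_schwarz x y; have := sqnorm_ge0 y.
have -> : dotv x y = a * b by lra.
have -> : sqnorm x = a * a by rewrite /sqnorm; lra.
have -> : sqnorm y = b * b - 1 by rewrite /sqnorm; lra.
move=> h1 h2; have a0 : a = 0.
  have : a ^+ 2 <= 0 by nra.
  by move=> h; apply/eqP; rewrite -sqrf_eq0 eq_le h sqr_ge0.
by split => //; apply: sqnorm0_eq0; rewrite /sqnorm; move: xx; rewrite a0; lra.
Qed.

(** Time and space components of the stereographic lift from the ball to the upper sheet of the
    hyperboloid. *)
Definition hlift0 y : R := (1 + sqnorm y) / (1 - sqnorm y).
Definition hlift1 y : 'rV[R]_k := (2 / (1 - sqnorm y)) *: y.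

(* [ch] is the hyperbolic cosine of [hdist], expressed in [chE] as the Lorentz
   product of the lifts [(hlift0, hlift1)] to the hyperboloid. *)
Definition ch x y : R :=
  1 + 2 * sqnorm (x - y) / ((1 - sqnorm x) * (1 - sqnorm y)).

Lemma unit_ballP y : unit_ball y -> 0 < 1 - sqnorm y.
Proof. by rewrite /unit_ball /= subr_gt0. Qed.

Lemma chE x y : unit_ball x -> unit_ball y ->
  ch x y = lor (hlift0 x) (hlift1 x) (hlift0 y) (hlift1 y).
Proof.
move=> /unit_ballP x1 /unit_ballP y1; rewrite /ch /lor /hlift0 /hlift1 sqnormB !dotvE.
by field; rewrite !gt_eqF.
Qed.

Lemma chxx x : ch x x = 1.
Proof. by rewrite /ch subrr /sqnorm dot0v mulr0 mul0r addr0. Qed.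

Lemma chC x y : ch x y = ch y x.
Proof. by rewrite /ch -(sqnormN (x - y)) opprB (mulrC (1 - sqnorm x)). Qed.

Lemma ch_ge1 x y : unit_ball x -> unit_ball y -> 1 <= ch x y.
Proof.
move=> /unit_ballP x1 /unit_ballP y1; rewrite /ch lerDl divr_ge0 //.
  by rewrite mulr_ge0 // sqnorm_ge0.
by rewrite mulr_ge0 // ltW.
Qed.

Lemma hdistC x y : hdist x y = hdist y x.
Proof. by rewrite /hdist -/(ch x y) chC. Qed.

Lemma cosh_hdist x y : unit_ball x -> unit_ball y -> cosh (hdist x y) = ch x y.
Proof. by move=> xb yb; rewrite /hdist arcoshK // ch_ge1. Qed.

Lemma hdist_ge0 x y : unit_ball x -> unit_ball y -> 0 <= hdist x y.
Proof. by move=> xb yb; rewrite /hdist arcosh_ge0 // ch_ge1. Qed.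

Lemma hdist_le x y (r : R) : unit_ball x -> unit_ball y -> 0 <= r ->
  (hdist x y <= r) = (ch x y <= cosh r).
Proof. by move=> xb yb r0; rewrite -cosh_hdist // ler_cosh // hdist_ge0. Qed.

Lemma hdist_lt x y (r : R) : unit_ball x -> unit_ball y -> 0 <= r ->
  (hdist x y < r) = (ch x y < cosh r).
Proof. by move=> xb yb r0; rewrite -cosh_hdist // ltr_cosh_mono // hdist_ge0. Qed.

Lemma exp_hdist_ge x y : unit_ball x -> unit_ball y -> ch x y <= expR (hdist x y).
Proof. by move=> xb yb; rewrite -cosh_hdist // cosh_le_exp // hdist_ge0. Qed.

Lemma exp_hdist_le x y : unit_ball x -> unit_ball y -> expR (hdist x y) <= 2 * ch x y.
Proof. by move=> xb yb; rewrite -cosh_hdist // exp_le_cosh. Qed.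

Lemma hdist_le_ln x y (c : R) : unit_ball x -> unit_ball y -> ch x y <= c ->
  hdist x y <= ln (2 * c).
Proof.
move=> xb yb xyc; rewrite -ler_expR lnK; last first.
  by rewrite posrE; have := ch_ge1 xb yb; lra.
by apply: (le_trans (exp_hdist_le xb yb)); rewrite ler_pM2l.
Qed.

(** Lorentz Cauchy-Schwarz based at the middle point [y] bounds [ch x z] by the addition formula for
    [cosh] of the sum of the two distances. *)
Lemma hdist_triangle y x z : unit_ball x -> unit_ball y -> unit_ball z ->
  hdist x z <= hdist x y + hdist y z.
Proof.
move=> xb yb zb; have a0 := hdist_ge0 xb yb; have b0 := hdist_ge0 yb zb.
rewrite hdist_le ?addr_ge0 // coshD !cosh_hdist //.
have yy : lor (hlift0 y) (hlift1 y) (hlift0 y) (hlift1 y) = 1 by rewrite -chE // chxx.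
have := lor_cauchy_schwarz (hlift0 x) (hlift1 x) (hlift0 z) (hlift1 z) yy.
rewrite -!chE // !chxx -(cosh_hdist xb yb) -(cosh_hdist zb yb) -!sqr_sinh -exprMn.
have s0 : 0 <= sinh (hdist x y) * sinh (hdist z y) by rewrite mulr_ge0 // sinh_ge0 // hdist_ge0.
rewrite (hdistC y z) (chC y z) -(cosh_hdist zb yb) -sqrrN opprB => h.
have : ch x z - cosh (hdist x y) * cosh (hdist z y) <= sinh (hdist x y) * sinh (hdist z y).
  by rewrite leNgt; apply/negP => h'; move: h; rewrite leNgt => /negP; apply; rewrite ltr_pXn2r ?nnegrE // (le_trans s0 (ltW h')).
by lra.
Qed.

(** The lift of [g t] minus the stated combination is orthogonal to the lift of [g t] and null,
    hence zero by [lor_null]. Both facts follow from the pairwise distances alone. *)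
Lemma geodesic_lift (I : set R) (g : R -> 'rV[R]_k) (a t b : R) :
  geodesic_on I g -> I a -> I t -> I b -> a <= t <= b -> a < b ->
  hlift0 (g t) = (sinh (b - t) * hlift0 (g a) + sinh (t - a) * hlift0 (g b)) / sinh (b - a) /\
  hlift1 (g t) = (sinh (b - a))^-1 *: (sinh (b - t) *: hlift1 (g a) + sinh (t - a) *: hlift1 (g b)).
Proof.
move=> [gB gd] Ia It Ib /andP[at_ tb] ab.
have bl s s' : I s -> I s' -> lor (hlift0 (g s)) (hlift1 (g s)) (hlift0 (g s')) (hlift1 (g s'))
   = cosh (s' - s).
  by move=> Is Is'; rewrite -chE; [rewrite -cosh_hdist ?gd ?cosh_abs -1?coshN ?opprB //; exact: gB|exact: gB|exact: gB].
have S0 : sinh (b - a) != 0 by rewrite gt_eqF // sinh_gt0 // subr_gt0.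
have := bl _ _ Ia Ib; have := bl _ _ Ia It; have := bl _ _ It Ib.
have := bl _ _ Ia Ia; have := bl _ _ It It; have := bl _ _ Ib Ib.
move: (hlift0 (g a)) (hlift1 (g a)) (hlift0 (g b)) (hlift1 (g b)) (hlift0 (g t)) (hlift1 (g t)).
move=> a0 a1 b0 b1 t0 t1.
have c0 : @cosh R 0 = 1 by rewrite /cosh oppr0 expR0; field.
rewrite !subrr c0 => bb tt aa tb1 at1 ab1.
set p := sinh (b - t) / sinh (b - a); set q := sinh (t - a) / sinh (b - a).
have [s1 s2] : sinh (b - a) = sinh (b - t) * cosh (t - a) + cosh (b - t) * sinh (t - a) /\
  cosh (b - a) = cosh (b - t) * cosh (t - a) + sinh (b - t) * sinh (t - a).
  split; last by rewrite -coshD; congr cosh; ring.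
  rewrite /sinh /cosh.
  have -> : b - a = (b - t) + (t - a) by ring.
  by rewrite opprD !expRD; field.
have q1 := sqr_sinh (b - t); have q2 := sqr_sinh (t - a); have q3 := sqr_sinh (b - a).
have tt' : lor (t0 - (p * a0 + q * b0)) (t1 - (p *: a1 + q *: b1)) t0 t1 = 0.
  have -> : lor (t0 - (p * a0 + q * b0)) (t1 - (p *: a1 + q *: b1)) t0 t1 =
    lor t0 t1 t0 t1 - p * lor a0 a1 t0 t1 - q * lor t0 t1 b0 b1.
    by rewrite /lor !dotvE (dotvC b1 t1); ring.
  rewrite tt at1 tb1 /p /q; apply: (mulIf S0); rewrite mul0r.
  transitivity (sinh (b - a) - sinh (b - t) * cosh (t - a) - sinh (t - a) * cosh (b - t)).
    by field.
  by rewrite s1; ring.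
have zz : lor (t0 - (p * a0 + q * b0)) (t1 - (p *: a1 + q *: b1))
              (t0 - (p * a0 + q * b0)) (t1 - (p *: a1 + q *: b1)) = 0.
  transitivity (lor (t0 - (p * a0 + q * b0)) (t1 - (p *: a1 + q *: b1)) t0 t1
     - (p * lor a0 a1 t0 t1 + q * lor t0 t1 b0 b1)
     + p ^+ 2 * lor a0 a1 a0 a1 + q ^+ 2 * lor b0 b1 b0 b1 + 2 * p * q * lor a0 a1 b0 b1).
    by rewrite /lor !dotvE (dotvC b1 t1) (dotvC b1 a1) (dotvC t1 a1); ring.
  rewrite tt' aa bb at1 tb1 ab1 /p /q.
  apply: (mulIf S0); apply: (mulIf S0); rewrite !mul0r.
  transitivity (sinh (b - t) ^+ 2 + sinh (t - a) ^+ 2 + 2 * sinh (b - t) * sinh (t - a) * cosh (b - a)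
    - sinh (b - a) * (sinh (b - t) * cosh (t - a) + cosh (b - t) * sinh (t - a))); first by field.
  rewrite -s1 -expr2 q3 s2.
  transitivity (sinh (b - t) ^+ 2 + sinh (t - a) ^+ 2 + 1 + sinh (b - t) ^+ 2 * sinh (t - a) ^+ 2 - cosh (b - t) ^+ 2 * cosh (t - a) ^+ 2); first by ring.
  by rewrite q1 q2; ring.
have [e0 e1] := lor_null tt tt' zz.
split.
  by move/eqP: e0; rewrite subr_eq0 => /eqP ->; rewrite /p /q; field.
move/eqP: e1; rewrite subr_eq0 => /eqP ->.
by rewrite /p /q scalerDr !scalerA ![in RHS](mulrC (sinh (b - a))^-1).
Qed.

End Hyperboloid.

(** * Half-spaces and convex hulls *)

Section Hull.
Context {R : realType} {k : nat}.
Implicit Types (x y z e xi u v : 'rV[R]_k) (Lambda : set 'rV[R]_k).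

(** A linear half-space of the hyperboloid, with denominators cleared so that the inequality also
    makes sense on the sphere, where it becomes [dotv y e <= c]. *)
Definition half_space e (c : R) : set 'rV[R]_k :=
  [set y | unit_ball y /\ 2 * dotv y e <= c * (1 + sqnorm y)].

Lemma half_spaceE e c y : unit_ball y ->
  half_space e c y <-> dotv (hlift1 y) e <= c * hlift0 y.
Proof.
move=> yb; have y1 := unit_ballP yb; rewrite /half_space /hlift1 /hlift0 /= dotvZl.
have -> : 2 / (1 - sqnorm y) * dotv y e = 2 * dotv y e / (1 - sqnorm y) by rewrite mulrAC.
by rewrite mulrA ler_pM2r ?invr_gt0 //; split => [[]|].
Qed.

Lemma half_space_between I (g : R -> 'rV[R]_k) (a t b : R) e c :
  geodesic_on I g -> I a -> I t -> I b -> a <= t <= b ->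
  half_space e c (g a) -> half_space e c (g b) -> half_space e c (g t).
Proof.
move=> gI Ia It Ib atb; have [ab|ab'] := eqVneq a b.
  by move=> _; suff -> : t = b by []; apply/eqP; rewrite eq_le -{2}ab andbC.
have [ga gt gb] : [/\ unit_ball (g a), unit_ball (g t) & unit_ball (g b)].
  by split; apply: gI.1.
have ab : a < b by rewrite lt_neqAle ab' /=; case/andP: atb; exact: le_trans.
move=> /(half_spaceE e c ga) ha /(half_spaceE e c gb) hb; apply/half_spaceE => //.
have [-> ->] := geodesic_lift gI Ia It Ib atb ab.
have S0 : 0 < sinh (b - a) by rewrite sinh_gt0 // subr_gt0.
have [s1 s2] : 0 <= sinh (b - t) /\ 0 <= sinh (t - a).
  by case/andP: atb => at_ tb; split; apply: sinh_ge0; rewrite subr_ge0.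
move: (hlift1 (g a)) (hlift1 (g b)) ha hb => ya yb ha hb.
rewrite !dotvE [leLHS]mulrC [leRHS]mulrA ler_pM2r ?invr_gt0 //.
by rewrite mulrDr lerD // [leRHS]mulrCA ler_wpM2l.
Qed.

Lemma half_space_hconvex e c : hconvex (half_space e c).
Proof.
split; first by move=> y [].
move=> a b g ab gI ga gb _ [t tab <-].
apply: (half_space_between gI _ tab _ _ ga gb) => //=.
- by rewrite in_itv /= lexx.
- by rewrite in_itv /= lexx andbT.
Qed.

Lemma dotv_continuous e : continuous (fun y : 'rV[R]_k => dotv y e).
Proof.
apply: continuous_big => [|i _ y]; first exact: add_continuous.
by apply: (@cvgM _ _ (nbhs y)); [exact: coord_continuous|exact: cvg_cst].
Qed.

Lemma sqnorm_continuous : continuous (@sqnorm R k).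
Proof.
apply: continuous_big => [|i _ y]; first exact: add_continuous.
by apply: (@cvgM _ _ (nbhs y)); exact: coord_continuous.
Qed.

Lemma near_half_space (F : set_system R) (FF : Filter F) (g : R -> 'rV[R]_k) xi e c :
  g t @[t --> F] --> xi -> sqnorm xi = 1 -> dotv xi e < c ->
  (forall t, unit_ball (g t)) -> \forall t \near F, half_space e c (g t).
Proof.
move=> gxi xi1 xic gB.
have : 2 * dotv (g t) e - c * (1 + sqnorm (g t)) @[t --> F] -->
   2 * dotv xi e - c * (1 + sqnorm xi).
  apply: cvgB; apply: cvgM; try exact: cvg_cst.
    exact: (cvg_comp g (fun y => dotv y e) gxi (@dotv_continuous e xi)).
  apply: cvgD; first exact: cvg_cst.
  exact: (cvg_comp g sqnorm gxi (@sqnorm_continuous xi)).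
move=> /cvgr_lt /(_ 0) h; have : 2 * dotv xi e - c * (1 + sqnorm xi) < 0 by rewrite xi1; lra.
move=> /h; apply: filterS => t ht; split; [exact: gB|lra].
Qed.

(** A geodesic line with both ends strictly inside the half-space has far points on either side
    lying in it, and every point of the line is between two such points. *)
Lemma hull_half_space_lt Lambda e c : Lambda `<=` unit_sphere ->
  (forall xi, Lambda xi -> dotv xi e < c) -> hhull Lambda `<=` half_space e c.
Proof.
move=> LS Lc; apply: smallest_sub; first exact: half_space_hconvex.
move=> x [g [u [v [gg [Lu Lv] gu gv [t _ <-]]]]].
have gB s : unit_ball (g s) by apply: gg.1.
have [M1 [_ h1]] : \forall t \near -oo, half_space e c (g t).
  by apply: (near_half_space _ gu) => //; [exact: LS|exact: Lc].
have [M2 [_ h2]] : \forall t \near +oo, half_space e c (g t).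
  by apply: (near_half_space _ gv) => //; [exact: LS|exact: Lc].
apply: (@half_space_between setT g (Num.min M1 t - 1) t (Num.max M2 t + 1)) => //.
- by rewrite lerBlDr ler_wpDr // ?ge_min ?lexx ?orbT //= ler_wpDr // le_max lexx orbT.
- by apply: h1; rewrite ltrBlDr ltr_pwDr // ge_min lexx.
- by apply: h2; rewrite ltr_pwDr // le_max lexx.
Qed.

Lemma hull_half_space Lambda e c : Lambda `<=` unit_sphere ->
  (forall xi, Lambda xi -> dotv xi e <= c) -> hhull Lambda `<=` half_space e c.
Proof.
move=> LS Lc y Hy.
have yb : unit_ball y.
  by have [] := @hull_half_space_lt Lambda e (c + 1) LS (fun xi h => le_lt_trans (Lc xi h) (ltr_pwDr ltr01 (lexx c))) y Hy.
split => //; apply/ler_addgt0Pr => d d0.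
have h : forall xi, Lambda xi -> dotv xi e < c + d / 2.
  by move=> xi /Lc h; apply: (le_lt_trans h); rewrite ltrDl divr_gt0.
have [_ h'] := hull_half_space_lt LS h Hy; apply: (le_trans h').
have := unit_ballP yb; have := sqnorm_ge0 y => h1 h2.
nra.
Qed.

Lemma hull_ball Lambda : Lambda `<=` unit_sphere -> hhull Lambda `<=` unit_ball.
Proof.
move=> LS y Hy; suff [] : half_space 0 0 y by [].
by apply: (hull_half_space LS) Hy => xi _; rewrite dotvC dot0v.
Qed.

Lemma unit_sphere_dot xi u : sqnorm xi = 1 -> sqnorm u = 1 ->
  2 * dotv xi u = 2 - sqnorm (xi - u).
Proof. by move=> x1 u1; rewrite sqnormB x1 u1; ring. Qed.

(** If [u] were the only point of [Lambda], the hull would lie in the half-space with [e = - u] and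
    [c = -1], which contains no point of the open ball; for empty [Lambda], [e = 0] and [c = -1] do
    the same. *)
Lemma hull_two_points Lambda : Lambda `<=` unit_sphere -> hhull Lambda !=set0 ->
  exists u v, [/\ Lambda u, Lambda v & u <> v].
Proof.
move=> LS [y Hy]; have yb := hull_ball LS Hy; apply/not_existsP => h.
have [[u Lu]|L0] := pselect (exists u, Lambda u).
  have Le xi : Lambda xi -> dotv xi (- u) <= -1.
    move=> Lxi; suff -> : xi = u by rewrite dotvNr -/(sqnorm u) LS.
    by apply: contrapT => xiu; apply: (h xi); exists u.
  have [_] := hull_half_space LS Le Hy; rewrite dotvNr => h1.
  have := sqnorm_ge0 (y - u); rewrite sqnormB (LS u Lu) => h2.
  have : sqnorm (y - u) = 0 by have := sqnorm_ge0 (y - u); rewrite sqnormB (LS u Lu); lra.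
  move=> /sqnorm0_eq0/eqP; rewrite subr_eq0 => /eqP yu.
  by move: yb; rewrite /unit_ball /= yu (LS u Lu) ltxx.
have Le xi : Lambda xi -> dotv xi 0 <= -1 by move=> Lxi; exfalso; apply: L0; exists xi.
have [_] := hull_half_space LS Le Hy; rewrite dotvC dot0v.
by have := sqnorm_ge0 y; lra.
Qed.

Definition enorm x : R := Num.sqrt (sqnorm x).

Lemma enorm_ge0 x : 0 <= enorm x. Proof. exact: sqrtr_ge0. Qed.

Lemma sqr_enorm x : enorm x ^+ 2 = sqnorm x.
Proof. by rewrite sqr_sqrtr // sqnorm_ge0. Qed.

Lemma enorm_le x (a : R) : 0 <= a -> (enorm x <= a) = (sqnorm x <= a ^+ 2).
Proof. by move=> a0; rewrite -sqr_enorm ler_pXn2r // ?nnegrE // enorm_ge0. Qed.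

Lemma enormD x y : enorm (x + y) <= enorm x + enorm y.
Proof.
rewrite enorm_le ?addr_ge0 ?enorm_ge0 // sqnormD -!sqr_enorm sqrrD mulr_natl.
have : dotv x y <= enorm x * enorm y.
  have := cauchy_schwarz x y; rewrite -!sqr_enorm -exprMn => h.
  have s0 : 0 <= enorm x * enorm y by rewrite mulr_ge0 // enorm_ge0.
  rewrite leNgt; apply/negP => h'; move: h; rewrite leNgt => /negP; apply.
  by rewrite ltr_pXn2r ?nnegrE // (le_trans s0 (ltW h')).
by lra.
Qed.

Lemma enormZ (a : R) x : enorm (a *: x) = `|a| * enorm x.
Proof. by rewrite /enorm sqnormZ sqrtrM ?sqr_ge0 // sqrtr_sqr. Qed.

Lemma enormN x : enorm (- x) = enorm x. Proof. by rewrite /enorm sqnormN. Qed.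

Lemma enormBC x y : enorm (x - y) = enorm (y - x). Proof. by rewrite -enormN opprB. Qed.

Lemma enorm_triangle y x z : enorm (x - z) <= enorm (x - y) + enorm (y - z).
Proof. by apply: le_trans (enormD _ _); rewrite addrA subrK. Qed.

Lemma enorm_lt1 x : (enorm x < 1) = (sqnorm x < 1).
Proof. by rewrite -sqr_enorm -[X in _ = (_ < X)](expr1n _ 2) ltr_pXn2r ?nnegrE ?enorm_ge0. Qed.

(* A hull point x is separated from Lambda by the boundary of a half-space as
   soon as the cap of radius comparable to 1 - |x| around x / |x| misses
   Lambda. *)
Lemma hull_shadow Lambda x : Lambda `<=` unit_sphere -> hhull Lambda x -> x != 0 ->
  exists2 xi, Lambda xi & enorm ((enorm x)^-1 *: x - xi) <= 2 * (1 - enorm x).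
Proof.
move=> LS Hx x0; have xb := hull_ball LS Hx.
have n1 : enorm x < 1 by rewrite enorm_lt1.
have n0 : 0 < enorm x.
  rewrite lt_neqAle enorm_ge0 andbT eq_sym; apply: contra x0 => /eqP n0.
  by apply/eqP/sqnorm0_eq0; rewrite -sqr_enorm n0 expr0n.
set e := _ *: x; have e1 : sqnorm e = 1.
  by rewrite /e sqnormZ -sqr_enorm exprVn mulVf // sqrf_eq0 gt_eqF.
apply: contrapT => h.
(* A chord longer than [2 * (1 - enorm x)] gives this bound on the dot product; the resulting
   half-space misses [x] by [(1 - r) ^+ 2 * (1 + 2 * r ^+ 2)], with [r] the norm of [x]. *)
have Le xi : Lambda xi -> dotv xi e <= 1 - 2 * (1 - enorm x) ^+ 2.
  move=> Lxi; rewrite leNgt; apply/negP => h'; apply: h; exists xi => //.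
  rewrite enorm_le; last by rewrite mulr_ge0 // subr_ge0 ltW.
  rewrite sqnormB e1 (LS xi Lxi) (dotvC e); nra.
have [_] := hull_half_space LS Le Hx.
have -> : dotv x e = enorm x.
  by rewrite /e dotvZr -/(sqnorm x) -sqr_enorm expr2 mulKf // gt_eqF.
rewrite -sqr_enorm; move: (enorm x) n0 n1 => r r0 r1.
rewrite leNgt => /negP; apply.
have : 0 < (1 - r) ^+ 2 * (1 + 2 * r ^+ 2).
  by rewrite mulr_gt0 // ?exprn_gt0 ?subr_gt0 //; nra.
by move=> h'; rewrite -subr_gt0; move: h'; congr (_ < _); ring.
Qed.

End Hull.

(** * Geodesics with prescribed end points *)

Section Geodesic.
Context {R : realType} {k : nat}.
Implicit Types (x y z e xi u v : 'rV[R]_k) (Lambda : set 'rV[R]_k).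

(* In the hyperboloid model this is the normalised combination
   [expR t * (1, xi) + expR (- t) * (1, u)] of two null vectors. *)
Definition geo xi u (t : R) : 'rV[R]_k :=
  (enorm (xi - u) + expR t + expR (- t))^-1 *: (expR t *: xi + expR (- t) *: u).

Lemma enorm_gt0 x : x <> 0 -> 0 < enorm x.
Proof.
move=> x0; rewrite lt_neqAle enorm_ge0 andbT eq_sym; apply/eqP => n0.
by apply: x0; apply: sqnorm0_eq0; rewrite -sqr_enorm n0 expr0n.
Qed.

Section TwoPoints.
Variables (xi u : 'rV[R]_k).
Hypotheses (xi1 : sqnorm xi = 1) (u1 : sqnorm u = 1) (xiu : xi <> u).
Let L := enorm (xi - u).

Let L_gt0 : 0 < L.
Proof. by apply: enorm_gt0 => /eqP; rewrite subr_eq0 => /eqP. Qed.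

Let dotxiu : dotv xi u = 1 - L ^+ 2 / 2.
Proof. by have := unit_sphere_dot xi1 u1; rewrite -sqr_enorm -/L; lra. Qed.

Let geo_sqnorm t : 1 - sqnorm (geo xi u t) = 2 * L / (L + expR t + expR (- t)) /\
  1 + sqnorm (geo xi u t) = 2 * (expR t + expR (- t)) / (L + expR t + expR (- t)).
Proof.
have E := expR_mulN t; have e1 := expR_gt0 t; have e2 := expR_gt0 (- t).
rewrite /geo -/L sqnormZ sqnormD !sqnormZ xi1 u1 !dotvE dotxiu.
move: (expR t) (expR (- t)) e1 e2 E => a b a0 b0 ab; have L0 := L_gt0.
have D0 : L + a + b != 0 by rewrite gt_eqF // !addr_gt0.
have -> : a ^+ 2 * 1 + b ^+ 2 * 1 + 2 * (a * (b * (1 - L ^+ 2 / 2))) = (a + b) ^+ 2 - (a * b) * L ^+ 2.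
  by field.
by rewrite ab mul1r; split; field.
Qed.

Lemma geo_ball t : unit_ball (geo xi u t).
Proof.
rewrite /unit_ball /= -subr_gt0 (geo_sqnorm t).1 divr_gt0 ?mulr_gt0 //.
by rewrite !addr_gt0 ?expR_gt0.
Qed.

Lemma geo_lift t : hlift0 (geo xi u t) = (expR t + expR (- t)) / L /\
  hlift1 (geo xi u t) = L^-1 *: (expR t *: xi + expR (- t) *: u).
Proof.
have L0 := L_gt0.
have D0 : L + expR t + expR (- t) != 0 by rewrite gt_eqF // !addr_gt0 ?expR_gt0.
rewrite /hlift0 /hlift1 (geo_sqnorm t).1 (geo_sqnorm t).2; split.
  by field; rewrite D0 gt_eqF.
by rewrite /geo scalerA -/L; congr (_ *: _); field; rewrite D0 gt_eqF.
Qed.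

Lemma ch_geo s t : ch (geo xi u s) (geo xi u t) = cosh (s - t).
Proof.
have gs := geo_ball s; have gt := geo_ball t.
rewrite chE //; have [-> ->] := geo_lift s; have [-> ->] := geo_lift t.
rewrite /lor !dotvE (dotvC u xi) -/(sqnorm xi) -/(sqnorm u) xi1 u1 dotxiu.
rewrite /cosh opprB !expRD; have L0 := L_gt0; field.
by rewrite gt_eqF.
Qed.

Lemma geo_geodesic : geodesic_on setT (geo xi u).
Proof.
split=> [t _|s t _ _]; first exact: geo_ball.
by rewrite /hdist -/(ch _ _) ch_geo -cosh_abs coshK.
Qed.

Lemma geo_cvg : geo xi u t @[t --> +oo] --> xi.
Proof.
set C := `|u| + `|xi| + L * `|xi|.
have C0 : 0 <= C by rewrite !addr_ge0 // mulr_ge0 // ltW.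
have h t : 0 <= t -> `|xi - geo xi u t| <= C * expR (- t).
  move=> t0; have E := expR_mulN t; have e1 := expR_gt0 t; have e2 := expR_gt0 (- t).
  have L0 := L_gt0.
  have D0 : 0 < L + expR t + expR (- t) by rewrite !addr_gt0.
  have -> : xi - geo xi u t = (L + expR t + expR (- t))^-1 *: ((L + expR (- t)) *: xi - expR (- t) *: u).
    rewrite /geo -/L; apply: (scalerI (a := L + expR t + expR (- t))); first by rewrite gt_eqF.
    rewrite scalerA divff ?gt_eqF // scale1r scalerBr scalerA divff ?gt_eqF // scale1r.
    by rewrite opprD !scalerDl addrA; congr (_ - _); rewrite addrAC addrK.
  have nn : `|(L + expR (- t)) *: xi - expR (- t) *: u| <= C.
    apply: (le_trans (ler_normB _ _)); rewrite !normrZ !gtr0_norm ?addr_gt0 // mulrDl.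
    have e3 : expR (- t) <= 1 by rewrite -expR0 ler_expR; lra.
    by have := normr_ge0 u; have := normr_ge0 xi; rewrite /C => n1 n2; nra.
  rewrite normrZ gtr0_norm ?invr_gt0 // mulrC; apply: ler_pM => //.
    by rewrite invr_ge0 ltW.
  rewrite -[leRHS]invrK -expRN opprK lef_pV2 ?posrE //.
  by rewrite addrAC lerDr addr_ge0 // ltW.
apply/cvgrPdist_lt => d d0.
have := @cvgr_expR R => /cvgrPdist_lt /(_ (d / (C + 1))).
have dC : 0 < d / (C + 1) by rewrite divr_gt0 // ltr_wpDl.
move=> /(_ dC) H; near=> t.
have t0 : 0 <= t by near: t; apply: nbhs_pinfty_ge; exact: num_real.
apply: (le_lt_trans (h t t0)).
have : `|0 - expR (- t)| < d / (C + 1) by near: t.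
rewrite sub0r normrN gtr0_norm ?expR_gt0 // ltr_pdivlMr ?ltr_wpDl // => h'.
by apply: le_lt_trans h'; rewrite mulrC ler_wpM2l ?expR_ge0 // lerDl.
Unshelve. all: by end_near. Qed.

(** The ray and the geodesic are asymptotic at [xi]. Pairing [p] with the parameter where
    [expR t = (1 - p)^-1] makes the Lorentz product explicit, with a bound depending only on the
    chord [L]. *)
Lemma geo_near_ray (p : R) : 0 <= p < 1 ->
  exists t, ch (p *: xi) (geo xi u t) <= 5 / L.
Proof.
move=> /andP[p0 p1]; exists (- ln (1 - p)).
have q0 : 0 < 1 - p by rewrite subr_gt0.
have pb : unit_ball (p *: xi).
  by rewrite /unit_ball /= sqnormZ xi1 mulr1 expr_lt1.
have gt := geo_ball (- ln (1 - p)).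
rewrite chE //; have [-> ->] := geo_lift (- ln (1 - p)).
rewrite opprK expRN lnK ?posrE // /lor /hlift0 /hlift1 sqnormZ xi1 mulr1 !dotvE -/(sqnorm xi) xi1 dotxiu mulr1.
have L0 := L_gt0.
have L4 : L ^+ 2 <= 4.
  have := sqnorm_ge0 (xi + u); rewrite sqnormD xi1 u1 dotxiu; lra.
have -> : (1 + p ^+ 2) / (1 - p ^+ 2) * (((1 - p)^-1 + (1 - p)) / L) -
  2 / (1 - p ^+ 2) * (p * (L^-1 * ((1 - p)^-1 + (1 - p) * (1 - L ^+ 2 / 2)))) =
   (1 + ((1 - p) ^+ 2 + p * L ^+ 2)) / (1 + p) / L.
  have q1 : 1 - p ^+ 2 != 0 by rewrite gt_eqF // subr_gt0 expr_lt1.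
  have q2 : 1 + p != 0 by rewrite gt_eqF //; lra.
  by field; rewrite q1 q2 !gt_eqF.
rewrite ler_pM2r ?invr_gt0 // ler_pdivrMr; last lra.
nra.
Qed.

End TwoPoints.

Lemma geoC xi u t : geo xi u (- t) = geo u xi t.
Proof. by rewrite /geo opprK enormBC -!addrA (addrC (expR t)) (addrC (expR t *: u)). Qed.

Lemma geo_hull Lambda xi u t : Lambda `<=` unit_sphere -> Lambda xi -> Lambda u ->
  xi <> u -> hhull Lambda (geo xi u t).
Proof.
move=> LS Lxi Lu xiu; apply: sub_gen_smallest.
exists (geo xi u), u, xi; split => //.
- exact: geo_geodesic (LS _ Lxi) (LS _ Lu) xiu.
- apply/cvgNy_compNP.
  rewrite (_ : _ \o _ = geo u xi); last by apply/funext => s /=; rewrite geoC.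
  exact: geo_cvg (nesym xiu).
- exact: geo_cvg.
Qed.

(** Uniformity in [xi]: of two fixed distinct points [u], [v] of [Lambda], at least one is at chord
    distance [enorm (u - v) / 2] or more from [xi], and serves as the other end of a geodesic. *)
Lemma hull_near_rays Lambda : Lambda `<=` unit_sphere -> hhull Lambda !=set0 ->
  exists C : R, forall xi p, Lambda xi -> 0 <= p < 1 ->
    exists2 h, hhull Lambda h & ch (p *: xi) h <= C.
Proof.
move=> LS H0; have [u [v [Lu Lv uv]]] := hull_two_points LS H0.
have l0 : 0 < enorm (u - v) by apply: enorm_gt0 => /eqP; rewrite subr_eq0 => /eqP.
exists (10 / enorm (u - v)) => xi p Lxi p01.
have [w [Lw xiw]] : exists w, Lambda w /\ enorm (u - v) / 2 <= enorm (xi - w).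
  have := enorm_triangle xi u v; rewrite (enormBC u xi) => tr.
  have [h|h] := leP (enorm (u - v) / 2) (enorm (xi - u)); first by exists u.
  by exists v; split => //; lra.
have xw : xi <> w.
  by move=> xw; move: xiw; rewrite xw subrr /enorm /sqnorm dot0v sqrtr0 -/(enorm _); lra.
have [t ht] := geo_near_ray (LS _ Lxi) (LS _ Lw) xw p01.
exists (geo xi w t); first exact: geo_hull.
apply: (le_trans ht).
rewrite ler_pdivrMr; last by lra.
rewrite mulrAC ler_pdivlMr //; lra.
Qed.

End Geodesic.

(** * Lebesgue measure of cubes *)

Section ConsMeasure.
Context {R : realType} {k : nat}.
Local Notation mR := (measurableTypeR R).
Variable m : {sigma_finite_measure set (k.-tuple mR) -> \bar R}.

Definition tuple_cons (p : mR * k.-tuple mR) : k.+1.-tuple mR :=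
  [the k.+1.-tuple mR of p.1 :: p.2].

Lemma measurable_tuple_cons : measurable_fun setT tuple_cons.
Proof. by apply: measurable_cons. Qed.

(** The successor step of [lebesgue_tuple], over an arbitrary sigma-finite [m] so that the measure
    structure can be built by induction on the dimension. *)
Definition cons_measure : set (k.+1.-tuple mR) -> \bar R :=
  pushforward (product_measure1 (@lebesgue_measure R) m) tuple_cons.

Lemma cons_measure_measure :
  [/\ cons_measure set0 = 0%E, forall A, (0 <= cons_measure A)%E &
      semi_sigma_additive cons_measure].
Proof.
have [M ->] : exists M : {measure set (k.+1.-tuple mR) -> \bar R},
    cons_measure = M.
  by unshelve refine (ex_intro _ (pushforward (product_measure1 (@lebesgue_measure R) m) tuple_cons : {measure set _ -> \bar R}) erefl); exact: measurable_tuple_cons.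
by split => [|A|]; [exact: measure0|exact: measure_ge0|exact: measure_semi_sigma_additive].
Qed.

HB.instance Definition _ := let: And3 m0 mge0 mS := cons_measure_measure in
  isMeasure.Build _ _ _ cons_measure m0 mge0 mS.

Definition tuple_uncons (t : k.+1.-tuple mR) : mR * k.-tuple mR :=
  (tnth t ord0, [tuple of behead t]).

Lemma measurable_tuple_uncons : measurable_fun setT tuple_uncons.
Proof.
by apply: measurable_fun_pair; [exact: measurable_tnth|exact: measurable_behead].
Qed.

Lemma tuple_consK : cancel tuple_cons tuple_uncons.
Proof. by case=> a t; rewrite /tuple_uncons /tuple_cons /=; congr (_, _); apply/val_inj. Qed.

Lemma cons_measure_rect (A : set mR) (B : set (k.-tuple mR)) :
  measurable A -> measurable B ->
  cons_measure (tuple_uncons @^-1` (A `*` B)) = (lebesgue_measure A * m B)%E.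
Proof.
move=> mA mB; rewrite /cons_measure /pushforward -comp_preimage.
rewrite (_ : _ \o _ = id); last by apply/funext => p /=; rewrite tuple_consK.
by rewrite preimage_id product_measure1E.
Qed.

Lemma measurable_cons_rect (A : set mR) (B : set (k.-tuple mR)) :
  measurable A -> measurable B -> measurable (tuple_uncons @^-1` (A `*` B)).
Proof.
move=> mA mB; rewrite -[X in measurable X]setTI.
by apply: measurable_tuple_uncons => //; exact: measurableX.
Qed.

Lemma lebesgue_itvoo (a b : R) : (a <= b)%R ->
  lebesgue_measure (`]a, b[%classic : set mR) = (b - a)%:E.
Proof.
move=> ab; rewrite lebesgue_measure_itv /= lte_fin; case: ltP => [_|ba]; first by rewrite EFinB.
by rewrite (le_anti (etrans (congr2 andb ab ba) erefl)) subrr.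
Qed.

Lemma cons_measure_sigma_finite : sigma_finite setT cons_measure.
Proof.
have /sigma_finiteP[G [TG ndG Goo]] := sigma_finiteT m.
exists (fun n => tuple_uncons @^-1` (`]- n%:R, n%:R[%classic `*` G n)).
  apply/esym; rewrite -subTset => t _.
  have [j _ Gj] : (\bigcup_i G i) (tuple_uncons t).2 by rewrite -TG.
  have [i ti] : exists i : nat, `|(tuple_uncons t).1| < i%:R.
    by exists (Num.bound `|(tuple_uncons t).1|); rewrite archi_boundP.
  exists (maxn i j) => //; split => /=.
    rewrite in_itv /=; move: ti; rewrite ltr_norml => /andP[t1 t2].
    have ij : i%:R <= (maxn i j)%:R :> R by rewrite ler_nat leq_maxl.
    by rewrite (lt_le_trans t2 ij) andbT (le_lt_trans _ t1) // lerN2.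
  by have /subsetPset := ndG _ _ (leq_maxr i j); exact.
move=> i; have [mG Gi] := Goo i; split; first exact: measurable_cons_rect.
rewrite cons_measure_rect // lebesgue_itvoo; last by rewrite (@le_trans _ _ 0) // oppr_le0.
by rewrite lte_mul_pinfty // lee_fin opprK addr_ge0.
Qed.

HB.instance Definition _ := Measure_isSigmaFinite.Build _ _ _ cons_measure
  cons_measure_sigma_finite.

End ConsMeasure.

(** The centre is a sequence indexed by [nat], independent of the dimension, so that dropping the
    first coordinate is composition with [S]. *)
Definition cube {R : realType} (k : nat) (c : nat -> R) (a : R) : set (k.-tuple (measurableTypeR R)) :=
  [set t | forall i : 'I_k, c i - a < tnth t i < c i + a].
Arguments cube {R} k c a.

Lemma cubeS {R : realType} (k : nat) (c : nat -> R) (a : R) :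
  cube k.+1 c a = tuple_uncons @^-1` (`]c 0 - a, c 0 + a[%classic `*` cube k (c \o S) a).
Proof.
have tb (t : k.+1.-tuple R) j : tnth t (lift ord0 j) = tnth [tuple of behead t] j.
  by rewrite [in LHS](tuple_eta t) tnthS.
apply/seteqP; split => t /=.
  move=> ct; split; first by rewrite in_itv /=; exact: (ct ord0).
  by move=> i; have := ct (lift ord0 i); rewrite tb /= /bump add1n.
rewrite in_itv /= => -[c0 cS] i; have [->//|i0] := eqVneq i ord0.
case: (unliftP ord0 i) i0 => [j ->|->]; last by rewrite eqxx.
by move=> _; rewrite tb; have := cS j; rewrite /= /bump add1n.
Qed.

(** The sigma-finite structure is carried existentially through the induction, since the product at
    each step requires it of the previous measure. *)
Lemma lebesgue_tuple_measure (R : realType) (k : nat) :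
  exists2 m : {sigma_finite_measure set (k.-tuple (measurableTypeR R)) -> \bar R},
    @lebesgue_tuple R k = m &
    forall c a, 0 <= a -> measurable (cube k c a) /\ m (cube k c a) = ((2 * a) ^+ k)%:E.
Proof.
elim: k => [|k [m mE IH]].
  exists (dirac [tuple] : {sigma_finite_measure set (0.-tuple (measurableTypeR R)) -> \bar R}) => // c a a0.
  have -> : cube 0 c a = setT by rewrite -subTset => t _ [].
  by split; [exact: measurableT|rewrite expr0; exact: diracT].
exists (cons_measure m : {sigma_finite_measure set (k.+1.-tuple (measurableTypeR R)) -> \bar R}).
  by rewrite /= mE.
move=> c a a0; have [mC CE] := IH (c \o S) a a0; rewrite cubeS; split.
  exact: measurable_cons_rect.
rewrite [LHS](@cons_measure_rect _ _ m `]c 0 - a, c 0 + a[%classic _ _ mC) // CE lebesgue_itvoo; last by lra.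
by rewrite -EFinM exprS; congr ((_ * _)%:E); ring.
Qed.

(** The integral of a nonnegative function is a supremum over simple functions below it, which grows
    with the function. Volumes of arbitrary sets can thus be compared with step functions. *)
Lemma ge0_integral_mono {d : measure_display} {T : measurableType d} {R : realType}
    (mu : {measure set T -> \bar R}) (f g : T -> \bar R) :
  (forall x, 0 <= f x)%E -> (forall x, f x <= g x)%E ->
  (\int[mu]_x f x <= \int[mu]_x g x)%E.
Proof.
move=> f0 fg; rewrite !ge0_integralTE //; last by move=> x; exact: le_trans (fg x).
by apply: ereal_sup_le => _ [h hf <-]; exists h => // x; exact: le_trans (fg x).
Qed.

Section Volume.
Context {R : realType} {n : nat}.
Local Notation k := n.+1.
Implicit Types (x y : 'rV[R]_k) (A : set 'rV[R]_k).

Definition vcube x (a : R) : set 'rV[R]_k := [set y | forall i, `|y 0 i - x 0 i| < a].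

Lemma vcube_cube x a : row_of_tuple @^-1` vcube x a = cube k (fun i => x 0 (inord i)) a.
Proof.
apply/seteqP; split => t /= h i; have := h i; rewrite /row_of_tuple mxE inord_val ltr_norml;
  by move=> /andP[h1 h2]; apply/andP; split; lra.
Qed.

Definition hdens y : R := (2 / (1 - sqnorm y)) ^+ k.

Lemma hdens_ge0 y : unit_ball y -> 0 <= hdens y.
Proof. by move=> /unit_ballP yb; rewrite exprn_ge0 // divr_ge0 // ltW. Qed.

Let step (s : seq 'rV[R]_k) (a w : 'rV[R]_k -> R) y : R :=
  \sum_(x <- s) w x * \1_(vcube x (a x)) y.

Let hvolE A (m : {sigma_finite_measure set (k.-tuple (measurableTypeR R)) -> \bar R}) :
  @lebesgue_tuple R k = m ->
  hvol A = (\int[m]_t (((fun y => (hdens y)%:E) \_ A) (row_of_tuple t)))%E.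
Proof.
move=> mE; rewrite /hvol mE integral_mkcond.
by apply: eq_integral => t _; rewrite /patch /hdens; congr (if _ then _ else _);
  apply/idP/idP => /set_mem ?; exact/mem_set.
Qed.

Let integral_step s a w (m : {sigma_finite_measure set (k.-tuple (measurableTypeR R)) -> \bar R}) :
  (forall c b, 0 <= b -> measurable (cube k c b) /\ m (cube k c b) = ((2 * b) ^+ k)%:E) ->
  (forall x, 0 <= a x) -> (forall x, 0 <= w x) ->
  (\int[m]_t (step s a w (row_of_tuple t))%:E)%E = (\sum_(x <- s) w x * (2 * a x) ^+ k)%:E.
Proof.
move=> mC a0 w0.
have mc x : measurable (cube k (fun i => x 0 (inord i)) (a x)) by exact: (mC _ _ (a0 x)).1.
transitivity (\int[m]_t (\sum_(x <- s) (w x)%:E * (\1_(cube k (fun i => x 0 (inord i)) (a x)) t)%:E))%E.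
  apply: eq_integral => t _; rewrite /step -sumEFin; apply: eq_bigr => x _.
  by rewrite EFinM -vcube_cube !indicE.
rewrite ge0_integral_sum //; last first.
- by move=> x t _; rewrite mule_ge0 // lee_fin.
- move=> x; apply: measurable_funeM; apply/measurable_EFinP; exact: measurable_indic.
rewrite -sumEFin; apply: eq_bigr => x _; rewrite ge0_integralZl_EFin //; last by apply/measurable_EFinP; exact: measurable_indic.
rewrite integral_indic // setIT EFinM; congr (_ * _)%E.
exact: (mC _ _ (a0 x)).2.
Qed.

Lemma hvol_le_step s (a w : 'rV[R]_k -> R) A : A `<=` unit_ball ->
  (forall x, 0 <= a x) -> (forall x, 0 <= w x) ->
  (forall y, A y -> hdens y <= \sum_(x <- s) w x * \1_(vcube x (a x)) y) ->
  (hvol A <= (\sum_(x <- s) w x * (2 * a x) ^+ k)%:E)%E.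
Proof.
move=> AB a0 w0 h; have [m mE mC] := lebesgue_tuple_measure R k.
rewrite (hvolE _ mE) -(integral_step s mC a0 w0); apply: ge0_integral_mono => t.
  by rewrite /patch; case: ifPn => // /set_mem /AB; rewrite lee_fin; exact: hdens_ge0.
rewrite /patch; case: ifPn => [/set_mem /h|_]; rewrite lee_fin //.
by apply: sumr_ge0 => x _; rewrite mulr_ge0 // indicE.
Qed.

Lemma hvol_ge_step s (a w : 'rV[R]_k -> R) A :
  (forall x, 0 <= a x) -> (forall x, 0 <= w x) ->
  (forall y, A y -> \sum_(x <- s) w x * \1_(vcube x (a x)) y <= hdens y) ->
  (forall x y, x \in s -> vcube x (a x) y -> A y) ->
  ((\sum_(x <- s) w x * (2 * a x) ^+ k)%:E <= hvol A)%E.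
Proof.
move=> a0 w0 h sA; have [m mE mC] := lebesgue_tuple_measure R k.
rewrite (hvolE _ mE) -(integral_step s mC a0 w0); apply: ge0_integral_mono => t.
  by rewrite lee_fin; apply: sumr_ge0 => x _; rewrite mulr_ge0 // indicE.
rewrite /patch; case: ifPn => [/set_mem /h|]; rewrite lee_fin // => /negP nA.
rewrite /step big_seq big1 // => x xs; rewrite indicE.
have [/set_mem /(sA _ _ xs)/mem_set//|_] := boolP (_ \in _); last by rewrite mulr0.
Qed.

End Volume.

(** * Volume and counting *)

Lemma sum_const_seq {R : pzRingType} {T : Type} (s : seq T) (c : R) :
  \sum_(x <- s) c = c * (size s)%:R.
Proof. by rewrite big_const_seq count_predT iter_addr_0 mulr_natr. Qed.

Section BallVolume.
Context {R : realType} {n : nat}.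
Local Notation k := n.+1.
Implicit Types (x y : 'rV[R]_k) (A : set 'rV[R]_k).

Lemma sqnorm_diff x y : unit_ball x -> unit_ball y ->
  sqnorm x - sqnorm y <= 2 * enorm (x - y).
Proof.
rewrite /unit_ball /= -!enorm_lt1 -!sqr_enorm => x1 y1.
have := enormD (x - y) y; rewrite subrK.
have := enorm_ge0 x; have := enorm_ge0 y; have := enorm_ge0 (x - y).
move: (enorm x) (enorm y) (enorm (x - y)) x1 y1 => a b d a1 b1 d0 b0 a0 h.
have [ab|ab] := leP a b; first by nra.
nra.
Qed.

Lemma enorm_vcube x y (a : R) : 0 <= a -> vcube x a y -> enorm (y - x) <= k%:R * a.
Proof.
move=> a0 h; rewrite enorm_le ?mulr_ge0 ?ler0n //.
apply: (le_trans (y := k%:R * a ^+ 2)).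
  by apply: sqnorm_le_coord => i; rewrite !mxE ltW.
rewrite exprMn ler_wpM2r ?sqr_ge0 // -natrX ler_nat expnS expn1.
by rewrite leq_pmulr.
Qed.

(** On a small Euclidean cube of side proportional to [1 - sqnorm x] the conformal factor varies by
    a bounded ratio, so its hyperbolic size is bounded independently of [x]. *)
Lemma vcube_small (r : R) : 0 < r -> exists2 c : R, 0 < c &
  forall x y, unit_ball x -> vcube x (c * (1 - sqnorm x)) y ->
    [/\ unit_ball y, 1 - sqnorm y <= 2 * (1 - sqnorm x) & hdist x y < r].
Proof.
move=> r0; have cr : 0 < cosh r - 1.
  have := @ltr_cosh R 0 r (lexx _) r0; have := @cosh_ge1 R 0.
  by move=> h1 h2; rewrite subr_gt0 (le_lt_trans h1).
(* The bound [8^-1] keeps [1 - sqnorm y] at least half of [1 - sqnorm x]; the other one controls the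
   distance. Dividing by the dimension below passes from the sup norm to the Euclidean norm. *)
set t := Num.min (8^-1) (cosh r - 1).
have t0 : 0 < t by rewrite lt_min invr_gt0 ltr0n cr.
have t8 : t <= 8^-1 by rewrite ge_min lexx.
have tr : t <= cosh r - 1 by rewrite ge_min lexx orbT.
have k0 : (0 : R) < k%:R by rewrite ltr0n.
exists (t / k%:R); first by rewrite divr_gt0.
move=> x y xb /enorm_vcube; have u0 := unit_ballP xb.
rewrite mulr_ge0 ?(ltW u0) ?divr_ge0 ?(ltW t0) ?(ltW k0) // => /(_ isT).
have -> : k%:R * (t / k%:R * (1 - sqnorm x)) = t * (1 - sqnorm x).
  by rewrite mulrA (mulrCA k%:R) divff ?mulr1 // gt_eqF.
move=> h; have d0 := enorm_ge0 (y - x).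
have x0 := enorm_ge0 x; have x1 : enorm x < 1 by rewrite enorm_lt1.
have y0 := enorm_ge0 y.
have yx : enorm y <= enorm x + enorm (y - x) by rewrite -{1}(subrK x y) addrC enormD.
have v2 : (1 - sqnorm x) / 2 <= 1 - sqnorm y.
  move: u0 h; rewrite -(sqr_enorm x) -(sqr_enorm y).
  move: (enorm x) (enorm y) (enorm (y - x)) x0 x1 y0 yx d0 => a b d a0 a1 b0 ba d0 u0 h.
  have : d <= (1 - a ^+ 2) / 8 by nra.
  nra.
have yb : unit_ball y by rewrite /unit_ball /=; lra.
have v0 := unit_ballP yb; split => //.
  by have := sqnorm_diff xb yb; rewrite enormBC; nra.
rewrite hdist_lt ?(ltW r0) // /ch.
rewrite -ltrBrDl ltr_pdivrMr ?mulr_gt0 // -(sqnormN (x - y)) opprB -sqr_enorm.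
move: (1 - sqnorm x) (1 - sqnorm y) (enorm (y - x)) u0 v0 v2 h d0 => u v d u0 v0 v2 h d0.
have : d ^+ 2 <= t ^+ 2 * u ^+ 2 by rewrite -exprMn ler_pXn2r // ?nnegrE // mulr_ge0 // ltW.
have : 0 < u * v by rewrite mulr_gt0.
have uv : u ^+ 2 <= 2 * (u * v) by nra.
move=> uv0 dd.
have h1 : 2 * d ^+ 2 <= 4 * t ^+ 2 * (u * v) by have := sqr_ge0 t; nra.
apply: (le_lt_trans h1); rewrite ltr_pM2r //; nra.
Qed.

(** Around each point of [s] sits a cube inside the ball of radius [r]; its side and the density on
    it compensate, so that it contributes at least a volume independent of the point. The separation
    makes the cubes disjoint. *)
Lemma hvol_packing (r : R) : 0 < r -> exists2 c : R, 0 < c &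
  forall (s : seq 'rV[R]_k) A, uniq s -> A `<=` unit_ball ->
    {in s, forall x, unit_ball x /\ hball x r `<=` A} ->
    {in s &, forall x y, x != y -> 2 * r <= hdist x y} ->
    ((c * (size s)%:R)%:E <= hvol A)%E.
Proof.
move=> r0; have [c c0 H] := vcube_small r0.
exists ((2 * c) ^+ k) => [|s A us AB sA sd]; first by rewrite exprn_gt0 // mulr_gt0.
have h x : x \in s -> 0 < 1 - sqnorm x by move=> /sA[/unit_ballP].
have := @hvol_ge_step R n s (fun x => c * `|1 - sqnorm x|) (fun x => (`|1 - sqnorm x| ^+ k)^-1) A.
have -> : \sum_(x <- s) (`|1 - sqnorm x| ^+ k)^-1 * (2 * (c * `|1 - sqnorm x|)) ^+ k =
  (2 * c) ^+ k * (size s)%:R.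
  rewrite -(sum_const_seq s) big_seq [RHS]big_seq; apply: eq_bigr => x /h xs.
  by rewrite mulrA [X in _ * X]exprMn mulrCA mulVf ?mulr1 // expf_neq0 // normr_eq0 gt_eqF.
apply=> [x|x|y Ay|x y xs]; first by rewrite mulr_ge0 // ltW.
- by rewrite invr_ge0 exprn_ge0.
- have vb := unit_ballP (AB y Ay).
  have [/hasP[x xs xy]|/hasPn no] := boolP (has (fun x => y \in vcube x (c * `|1 - sqnorm x|)) s); last first.
    rewrite big_seq big1 ?hdens_ge0 //; first exact: AB.
    by move=> x /no; rewrite indicE => /negbTE ->; rewrite mulr0.
  rewrite (bigD1_seq x) //= big_seq_cond big1 ?addr0; last first.
    move=> z /andP[zs zx]; rewrite indicE; have [zy|_] := boolP (y \in _); last by rewrite mulr0.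
    exfalso; have [xb _] := sA x xs; have [zb _] := sA z zs.
    move/set_mem: xy; rewrite gtr0_norm ?h // => /(H x y xb)[yb _ xy].
    move/set_mem: zy; rewrite gtr0_norm ?h // => /(H z y zb)[_ _ zy].
    have := sd z x zs xs zx; have := hdist_triangle zb yb xb.
    by rewrite (hdistC y x); lra.
  rewrite indicE xy mulr1; have [xb _] := sA x xs.
  move/set_mem: xy; rewrite gtr0_norm ?h // => /(H x y xb)[yb vu _].
  have u0 := h x xs; have i0 : 0 <= (1 - sqnorm x)^-1 by rewrite invr_ge0 ltW.
  have j0 : 0 <= 2 / (1 - sqnorm y) by rewrite divr_ge0 // ltW.
  rewrite -exprVn /hdens ler_pXn2r ?nnegrE //.
  by rewrite ler_pdivlMr // mulrC ler_pdivrMr.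
- have [xb xA] := sA x xs; rewrite gtr0_norm ?h // => /(H x y xb)[yb _ xy].
  by apply: xA; split => //; rewrite hdistC.
Qed.

(** Within distance [D] the factors [1 - sqnorm x] and [1 - sqnorm y] agree up to the ratio [K], so
    a cube of side proportional to [1 - sqnorm x], with a constant weight dominating the density,
    covers each ball of radius [D]. *)
Lemma hvol_covering (D : R) : 0 <= D -> exists2 C : R, 0 < C &
  forall (s : seq 'rV[R]_k) A, A `<=` unit_ball ->
    (forall y, A y -> exists x, [/\ x \in s, unit_ball x & hdist y x <= D]) ->
    (hvol A <= (C * (size s)%:R)%:E)%E.
Proof.
move=> D0; set K := 2 + 2 * cosh D.
have K1 : 1 <= K by have := cosh_ge1 D; rewrite /K; lra.
have K0 : 0 < K by lra.
(* To be read with [u], [v] the two factors, in either order, and [d] the Euclidean distance between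
   the points. *)
have H (u v d : R) : 0 < u -> 0 < v -> v - u <= 2 * d -> 0 <= d ->
    2 * d ^+ 2 <= cosh D * (u * v) -> v <= K * u.
  move=> u0 v0 vu d0 dd; have [h|h] := leP v u; first by nra.
  rewrite -(ler_pM2l v0).
  have : (v - u) ^+ 2 <= 4 * d ^+ 2.
    have h1 : 0 <= v - u by rewrite subr_ge0 ltW.
    have h2 : 0 <= 2 * d by rewrite mulr_ge0.
    have -> : 4 * d ^+ 2 = (2 * d) ^+ 2 by ring.
    by rewrite ler_pXn2r // nnegrE.
  have := sqr_ge0 u; rewrite /K; nra.
exists ((8 * K ^+ 2) ^+ k) => [|s A AB sA].
  by rewrite exprn_gt0 // mulr_gt0 // exprn_gt0.
have := @hvol_le_step R n [seq x <- s | sqnorm x < 1] (fun x => 2 * K * `|1 - sqnorm x|) (fun x => (2 * K / `|1 - sqnorm x|) ^+ k) A AB.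
have <- : \sum_(x <- [seq x <- s | sqnorm x < 1]) (8 * K ^+ 2) ^+ k =
  \sum_(x <- [seq x <- s | sqnorm x < 1])  (2 * K / `|1 - sqnorm x|) ^+ k * (2 * (2 * K * `|1 - sqnorm x|)) ^+ k.
  rewrite big_seq [RHS]big_seq; apply: eq_bigr => x; rewrite mem_filter -subr_gt0 => /andP[x0 _].
  rewrite -exprMn; congr (_ ^+ _); rewrite gtr0_norm //; field.
  by rewrite gt_eqF.
move=> P; apply: (le_trans (P _ _ _)).
- by move=> x; rewrite !mulr_ge0 // ltW.
- by move=> x; rewrite exprn_ge0 // divr_ge0 // mulr_ge0 // ltW.
- move=> y Ay; have yb := AB y Ay; have v0 := unit_ballP yb.
  have [x [xs xb xy]] := sA y Ay; have u0 := unit_ballP xb.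
  have d0 := enorm_ge0 (y - x).
  have dd : 2 * enorm (y - x) ^+ 2 <= cosh D * ((1 - sqnorm x) * (1 - sqnorm y)).
    move: xy; rewrite hdist_le // /ch -lerBrDl ler_pdivrMr ?mulr_gt0 // -sqr_enorm.
    move=> h; apply: (le_trans h); rewrite (mulrC (1 - sqnorm y)) ler_pM2r ?mulr_gt0 //; lra.
  have vu : 1 - sqnorm y <= K * (1 - sqnorm x).
    by apply: (H _ _ (enorm (y - x))) => //; have := sqnorm_diff xb yb; rewrite enormBC; lra.
  have uv : 1 - sqnorm x <= K * (1 - sqnorm y).
    apply: (H _ _ (enorm (y - x))) => //; first by have := sqnorm_diff yb xb; lra.
    by rewrite (mulrC (1 - sqnorm y)).
  have cy : y \in vcube x (2 * K * `|1 - sqnorm x|).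
    apply/mem_set => i; rewrite (gtr0_norm u0).
    have dK : enorm (y - x) <= K * (1 - sqnorm x).
      rewrite enorm_le; last by rewrite mulr_ge0 // ltW.
      rewrite -sqr_enorm; have := cosh_ge1 D; have := mulr_gt0 u0 u0.
      have : cosh D * ((1 - sqnorm x) * (1 - sqnorm y)) <= K * ((1 - sqnorm x) * (K * (1 - sqnorm x))).
        apply: ler_pM => //; [|exact: mulr_ge0 (ltW u0) (ltW v0)|rewrite /K|by rewrite ler_pM2l].
          by have := cosh_ge1 D; lra.
        by have := cosh_ge1 D; lra.
      nra.
    have ci : `|y 0 i - x 0 i| <= enorm (y - x).
      rewrite -(@ler_pXn2r _ 2) ?nnegrE // sqr_enorm real_normK ?num_real //.
      by have := sqnorm_coord (y - x) i; rewrite !mxE.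
    apply: (le_lt_trans ci); apply: (le_lt_trans dK).
    by rewrite -mulrA -[ltLHS]mul1r ltr_pM2r ?mulr_gt0 //; lra.
  rewrite (big_rem x) ?mem_filter ?xs ?andbT //=.
  rewrite indicE cy mulr1 ler_wpDr //.
    by apply: sumr_ge0 => z _; rewrite mulr_ge0 // exprn_ge0 // divr_ge0 // mulr_ge0 // ltW.
  rewrite gtr0_norm // /hdens ler_pXn2r ?nnegrE ?divr_ge0 ?mulr_ge0 ?(ltW K0) ?(ltW u0) ?(ltW v0) //.
  rewrite ler_pdivrMr // mulrAC ler_pdivlMr //; nra.
rewrite lee_fin sum_const_seq ler_wpM2l //.
  by rewrite exprn_ge0 // mulr_ge0 // sqr_ge0.
by rewrite ler_nat size_filter count_size.
Qed.

End BallVolume.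

(** * Renewal inequalities *)

Lemma renewal_growth {R : realType} (N : R -> R) (A rho sigma : R) (bs : seq R) :
  (forall r, r <= 0 -> N r = 0) -> 0 <= A -> 0 <= rho -> 0 <= sigma ->
  (forall r, N r <= A + rho * \sum_(b <- bs) N (r + b)) ->
  {in bs, forall b, b <= -1} ->
  rho * (\sum_(b <- bs) expR (sigma * b)) < 1 ->
  exists2 K, 0 <= K & forall r, N r <= K * expR (sigma * r).
Proof.
move=> N0 A0 rho0 s0 H b1; set q := rho * _ => q1.
have K0 : 0 <= A / (1 - q) by rewrite divr_ge0 // subr_ge0 ltW.
(* This constant [K] solves [K = A + q * K]; for [r > 0] the term [A] may be multiplied by
   [expR (sigma * r) >= 1]. Each shift [b <= -1] lowers the radius by at least one, hence the
   induction on an integer bound for [r]. *)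
exists (A / (1 - q)) => // r.
suff {r} P (j : nat) r : r <= j%:R -> N r <= A / (1 - q) * expR (sigma * r).
  by apply: (P (Num.truncn r).+1); apply: ltW; exact: truncnS_gt.
elim: j r => [|j IH] r rj; first by rewrite N0 // mulr_ge0 // expR_ge0.
have [r0|r0] := leP r 0; first by rewrite N0 // mulr_ge0 // expR_ge0.
apply: (le_trans (H r)).
have E1 : 1 <= expR (sigma * r) by rewrite -expR0 ler_expR mulr_ge0 // ltW.
have : rho * \sum_(b <- bs) N (r + b) <= q * (A / (1 - q) * expR (sigma * r)).
  rewrite /q -mulrA ler_wpM2l // mulr_suml big_seq [leRHS]big_seq; apply: ler_sum => b /b1 bb.
  apply: (le_trans (IH _ _)); first by move: rj; rewrite -natr1; lra.
  by rewrite mulrDr expRD mulrA mulrC.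
move=> h; apply: (le_trans (lerD (lexx A) h)).
move: K0; set K := A / (1 - q) => K0.
have -> : A = (1 - q) * K by rewrite /K mulrCA divff ?mulr1 // gt_eqF // subr_gt0.
have q2 : 0 <= 1 - q by rewrite subr_ge0 ltW.
have := mulr_ge0 (mulr_ge0 q2 K0) (etrans (subr_ge0 _ _) E1).
lra.
Qed.

(** A finite sum of exponentials depends continuously on the exponent: lowering [Delta] by [e] costs
    a factor at most [expR (e * B)], and [q * expR (e * B) < 1] as soon as [e * B < 1 - q]. *)
Lemma lower_exponent {R : realType} (rho Delta : R) (bs : seq R) : 0 < Delta -> 0 <= rho ->
  rho * (\sum_(b <- bs) expR (Delta * b)) < 1 ->
  exists sigma, [/\ 0 <= sigma, sigma < Delta & rho * (\sum_(b <- bs) expR (sigma * b)) < 1].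
Proof.
move=> D0 rho0; set q := rho * _ => q1.
have q0 : 0 <= q by rewrite mulr_ge0 // sumr_ge0 // => b _; exact: expR_ge0.
pose B := \sum_(b <- bs) `|b|.
have B0 : 0 <= B by rewrite sumr_ge0.
set e := Num.min Delta ((1 - q) / (B + 1)).
have e0 : 0 < e by rewrite lt_min D0 divr_gt0 ?subr_gt0 // ltr_wpDl.
have eB : e * B < 1 - q.
  have : e * (B + 1) <= 1 - q by rewrite -ler_pdivlMr ?ltr_wpDl // ge_min lexx orbT.
  nra.
exists (Delta - e); split; first by rewrite subr_ge0 ge_min lexx.
  by rewrite gtrBl.
have h : rho * (\sum_(b <- bs) expR ((Delta - e) * b)) <= q * expR (e * B).
  rewrite /q -mulrA ler_wpM2l // mulr_suml big_seq [leRHS]big_seq; apply: ler_sum => b bbs.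
  rewrite -expRD ler_expR.
  have bB : `|b| <= B by rewrite /B (big_rem b) //= lerDl sumr_ge0.
  have := lerNnormlW (lexx `|b|); nra.
apply: (le_lt_trans h).
rewrite -ltr_pdivlMr ?expR_gt0 // mul1r -expRN.
by apply: lt_le_trans (expR_ge1Dx _); lra.
Qed.

(** * Exponential growth of orbit-like sets and convergence of their exponential series *)

Section Growth.
Context {R : realType} {n : nat}.
Local Notation k := n.+1.
Implicit Types (x y z : 'rV[R]_k) (X : set 'rV[R]_k) (t : seq 'rV[R]_k).

(** Duplicate-free lists are counted instead of the set itself, so that the bound makes sense before
    the finiteness in [growth_finite] is known. *)
Definition growth X z (sigma K : R) := forall (r : R) t, uniq t ->
  {in t, forall x, X x /\ hball z r x} -> (size t)%:R <= K * expR (sigma * r).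

(** The points are grouped by the integer part of their distance to [z]; the group at level [J]
    contributes at most [C * q ^+ J], a convergent geometric series since [sigma < s]. *)
Lemma growth_esum X z (sigma K s : R) : X `<=` unit_ball -> unit_ball z ->
  0 <= K -> 0 <= sigma -> sigma < s -> growth X z sigma K ->
  (\esum_(x in X) (expR (- (s * hdist x z)))%:E < +oo)%E.
Proof.
move=> XB zb K0 s0 ss g.
set q := expR (sigma - s).
have q0 : 0 < q by exact: expR_gt0.
have q1 : q < 1 by rewrite -expR0 ltr_expR subr_lt0.
set C := K * expR sigma.
have C0 : 0 <= C by rewrite mulr_ge0 // expR_ge0.
suff h : (\esum_(x in X) (expR (- (s * hdist x z)))%:E <= (C / (1 - q))%:E)%E.
  by apply: le_lt_trans h _; exact: ltry.
apply: ge_ereal_sup => _ [F [finF FX] <-].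
rewrite fsbig_finite //= sumEFin lee_fin.
pose j x : nat := Num.truncn (hdist x z).
have d0 x : x \in fset_set F -> 0 <= hdist x z.
  by rewrite in_fset_set // => /set_mem /FX /XB xb; exact: hdist_ge0.
have jd x : x \in fset_set F -> (j x)%:R <= hdist x z < (j x).+1%:R.
  by move=> /d0; exact: truncn_itv.
apply: (@le_trans _ _ (\sum_(x <- fset_set F) expR (- (s * (j x)%:R)))).
  rewrite big_seq [leRHS]big_seq; apply: ler_sum => x /jd /andP[h _].
  by rewrite ler_expR lerN2 ler_pM2l // (le_lt_trans s0).
have P (J : nat) : \sum_(x <- fset_set F | (j x < J)%N) expR (- (s * (j x)%:R)) <=
    C * \sum_(i < J) q ^+ i.
  elim: J => [|J IH]; first by rewrite big_ord0 mulr0 big_pred0.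
  rewrite big_ord_recr /= mulrDr (bigID (fun x => (j x < J)%N)) /=; apply: lerD.
    by apply: le_trans IH; rewrite le_eqVlt; apply/orP; left; apply/eqP; apply: eq_bigl => x; rewrite ltnS; case: ltngtP.
  rewrite (eq_bigl (fun x => j x == J)); last by move=> x; rewrite ltnS -leqNgt -eqn_leq.
  rewrite (eq_bigr (fun=> expR (- (s * J%:R)))); last by move=> x /eqP ->.
  rewrite -big_filter sum_const_seq.
  have := g J.+1%:R [seq x <- fset_set F | j x == J].
  rewrite filter_uniq ?fset_uniq // => /(_ isT) h.
  have {h} : (size [seq x <- fset_set F | j x == J])%:R <= K * expR (sigma * J.+1%:R).
    apply: h => x; rewrite mem_filter => /andP[/eqP jx xF].
    have := jd x xF; move: xF; rewrite in_fset_set // => /set_mem/FX xX.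
    by rewrite jx => /andP[_ h]; split => //; split => //; exact: XB.
  move=> h; apply: (le_trans (ler_wpM2l (expR_ge0 _) h)).
  rewrite /C /q -expRM_natl -!mulrA mulrCA ler_wpM2l // -!expRD ler_expR -natr1.
  by lra.
have {}P J : \sum_(x <- fset_set F | (j x < J)%N) expR (- (s * (j x)%:R)) <= C / (1 - q).
  apply: (le_trans (P J)); rewrite ler_wpM2l //.
  rewrite -[leRHS]mul1r ler_pdivlMr ?subr_gt0 // -opprB mulrN mulrC -subrX1 opprB.
  by rewrite gerBl exprn_ge0 // ltW.
apply: le_trans (P (\max_(x <- fset_set F) (j x).+1)%N).
rewrite big_seq_cond [leRHS]big_seq_cond le_eqVlt; apply/orP; left; apply/eqP.
apply: eq_bigl => x; case: (boolP (x \in _)) => //= xF.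
by rewrite (leq_bigmax_seq _ xF).
Qed.

(** Every point of the ball of radius [r] contributes at least [expR (- (s * r))] to the series,
    whose sum serves as [K]. *)
Lemma esum_growth X z (s : R) : X `<=` unit_ball -> unit_ball z -> 0 <= s ->
  (\esum_(x in X) (expR (- (s * hdist x z)))%:E < +oo)%E ->
  exists2 K, 0 <= K & growth X z s K.
Proof.
move=> XB zb s0; set E := esum _ _ => Efin.
have E0 : (0 <= E)%E by apply: esum_ge0 => x _; rewrite lee_fin expR_ge0.
have EE : E = (fine E)%:E by rewrite fineK // ge0_fin_numE.
exists (fine E); first exact: fine_ge0.
move=> r t ut tX; rewrite -ler_pdivrMr ?expR_gt0 // -lee_fin -EE -expRN.
apply: esum_ge; exists [set` t].
  by split; [exact: finite_seq|move=> x /= /tX[]].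
rewrite -fsbig_seq // sumEFin lee_fin mulrC -sum_const_seq big_seq [leRHS]big_seq.
apply: ler_sum => x /tX[_ [_ xz]]; rewrite ler_expR lerN2.
by rewrite ler_wpM2l // ltW.
Qed.

Lemma growth_finite X z (sigma K r : R) : growth X z sigma K -> finite_set (X `&` hball z r).
Proof.
move=> g; apply: contrapT => /infinite_set_fset inf.
have [B BX] := inf (Num.truncn (K * expR (sigma * r))).+1.
have := g r B (fset_uniq B) (fun x xB => BX x xB).
move=> h h'; have := truncnS_gt (K * expR (sigma * r)); rewrite ltNge => /negP; apply.
by apply: le_trans h; rewrite ler_nat.
Qed.

Lemma growth_base X z z' (sigma K : R) : X `<=` unit_ball -> unit_ball z -> unit_ball z' ->
  0 <= K -> 0 <= sigma -> growth X z sigma K ->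
  growth X z' sigma (K * expR (sigma * hdist z z')).
Proof.
move=> XB zb zb' K0 s0 g r t ut tX.
rewrite -mulrA -expRD -mulrDr addrC; apply: g => // x /tX[Xx [xb xz']]; split => //.
by split => //; have := hdist_triangle xb zb' zb; rewrite (hdistC z' z); lra.
Qed.

Definition uniformly_separated X (m : R) := forall x y, X x -> X y -> x <> y -> m <= hdist x y.

(** Balls of radius [m / 2] about the points are packed into a ball of radius [r + m / 2], whose
    volume is bounded crudely by a bound on its density times a Euclidean cube. This yields
    finiteness in balls and an admissible exponent for the series. *)
Lemma separated_growth X z (m : R) : X `<=` unit_ball -> unit_ball z -> 0 < m ->
  uniformly_separated X m -> exists2 K, 0 <= K & growth X z k%:R K.
Proof.
move=> XB zb m0 sX.
have m2 : 0 < m / 2 by rewrite divr_gt0.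
have [c c0 pack] := @hvol_packing R n _ m2.
have z0 : @unit_ball R k 0 by rewrite /unit_ball /= /sqnorm dot0v.
pose L := (2 * expR (m / 2 + hdist z 0) * 2) ^+ k.
exists (L / c) => [|r t ut tX].
  by rewrite divr_ge0 ?(ltW c0) // exprn_ge0 // mulr_ge0 // mulr_ge0 // expR_ge0.
rewrite mulrAC ler_pdivlMr // mulrC -lee_fin.
have tb x : x \in t -> unit_ball x by move=> /tX[/XB].
pose A : set 'rV[R]_k := hball z (r + m / 2).
have AB : A `<=` unit_ball by move=> x [].
apply: (@le_trans _ _ (hvol A)).
  apply: pack => // [x xt|x y xt yt xy]; last first.
    by rewrite mulrC divfK ?pnatr_eq0 //; apply: sX; [exact: (tX x xt).1|exact: (tX y yt).1|exact/eqP].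
  split; first exact: tb.
  move=> y [yb yx]; split => //; have [_ [xb xz]] := tX x xt.
  by have := hdist_triangle yb xb zb; lra.
have := @hvol_le_step R n [:: 0] (fun=> 1) (fun=> (2 * expR (r + m / 2 + hdist z 0)) ^+ k) A AB.
rewrite big_seq1 mulr1 -exprMn => h.
have -> : L * expR (k%:R * r) = (2 * expR (r + m / 2 + hdist z 0) * 2) ^+ k.
  by rewrite /L expRM_natl -exprMn -addrA (expRD r); congr (_ ^+ _); ring.
apply: h => [x|x|y [yb yz]]; [by []|by rewrite exprn_ge0 // mulr_ge0 // expR_ge0|].
have v0 := unit_ballP yb.
rewrite big_seq1 indicE mem_set ?mulr1; last first.
  move=> i; rewrite mxE subr0 -(@ltr_pXn2r _ 2) ?nnegrE // expr1n real_normK ?num_real //.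
  by apply: le_lt_trans (sqnorm_coord y i) _; rewrite -subr_gt0.
have i0 : 0 <= 2 / (1 - sqnorm y) by rewrite divr_ge0 // ltW.
have e0 : 0 <= 2 * expR (r + m / 2 + hdist z 0) by rewrite mulr_ge0 // expR_ge0.
rewrite /hdens ler_pXn2r ?nnegrE // ler_pM2l //.
apply: (@le_trans _ _ (ch y 0)).
  rewrite /ch subr0 /sqnorm dot0v -/(sqnorm y) subr0 mulr1.
  rewrite -[leLHS]mul1r ler_pdivrMr // mulrDl mul1r divfK ?gt_eqF //.
  by have := sqnorm_ge0 y; lra.
apply: (le_trans (exp_hdist_ge yb z0)); rewrite ler_expR.
by have := hdist_triangle yb zb z0; lra.
Qed.

End Growth.

(** * Shadows and bounded type *)

Lemma size_le_count (T I : Type) (t : seq T) (s : seq I) (P0 : pred T) (P : I -> pred T) :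
  all (fun x => P0 x || has (P^~ x) s) t ->
  (size t <= count P0 t + \sum_(i <- s) count (P i) t)%N.
Proof.
have hs x s' : has (P^~ x) s' -> (1 <= \sum_(i <- s') P i x)%N.
  elim: s' => //= i s' IH; rewrite big_cons; case: (P i x) => //= /IH; exact.
elim: t => [|x t IH] //= /andP[Px /IH h].
have -> : (\sum_(i <- s) (P i x + count (P i) t) =
  \sum_(i <- s) P i x + \sum_(i <- s) count (P i) t)%N by rewrite big_split.
have : (1 <= P0 x + \sum_(i <- s) P i x)%N.
  by case/orP: Px => [->//|/hs h']; exact: leq_trans h' (leq_addl _ _).
by rewrite addnACA => h'; exact: leq_add h' h.
Qed.

Section Shadows.
Context {R : realType} {n : nat}.
Local Notation k := n.+1.
Implicit Types (x y z xi : 'rV[R]_k) (X Lambda : set 'rV[R]_k) (t : seq 'rV[R]_k).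

Lemma unit_ball0 : @unit_ball R k 0.
Proof. by rewrite /unit_ball /= /sqnorm dot0v. Qed.

Lemma ray_ball xi (p : R) : sqnorm xi = 1 -> 0 <= p < 1 -> unit_ball (p *: xi).
Proof. by move=> xi1 /andP[p0 p1]; rewrite /unit_ball /= sqnormZ xi1 mulr1 expr_lt1. Qed.

Lemma ch0E x : unit_ball x -> ch x 0 = (1 + sqnorm x) / (1 - sqnorm x).
Proof.
move=> /unit_ballP x0; rewrite /ch subr0 /sqnorm dot0v -/(sqnorm x) subr0 mulr1.
by field; rewrite gt_eqF.
Qed.

Lemma ch0_bounds x : unit_ball x ->
  (2 * (1 - enorm x))^-1 <= ch x 0 /\ ch x 0 <= (1 - enorm x)^-1.
Proof.
move=> xb; rewrite ch0E // -sqr_enorm.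
have x0 := enorm_ge0 x; have : enorm x < 1 by rewrite enorm_lt1.
move: (enorm x) x0 => a a0 a1; have u0 : 0 < 1 - a by lra.
have v0 : 0 < 1 - a ^+ 2 by nra.
split.
  rewrite -[leLHS]mul1r ler_pdivrMr ?mulr_gt0 // mulrAC ler_pdivlMr //.
  have : 0 <= (1 - a) * (1 - a + 2 * a ^+ 2) by apply: mulr_ge0; have := sqr_ge0 a; lra.
  lra.
rewrite ler_pdivrMr // mulrC ler_pdivlMr //.
have : 0 <= (1 - a) * (a * (1 - a)) by apply: mulr_ge0; [|apply: mulr_ge0]; lra.
lra.
Qed.

Lemma uniformly_distributed_near_rays Lambda X : Lambda `<=` unit_sphere ->
  uniformly_distributed (hhull Lambda) X -> X !=set0 ->
  exists2 D : R, 0 <= D & forall xi p, Lambda xi -> 0 <= p < 1 ->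
    exists2 x, X x & hdist x (p *: xi) <= D.
Proof.
move=> LS [XH [M XM] _] [x1 Xx1].
have [C HC] := hull_near_rays LS (ex_intro _ x1 (XH _ Xx1)).
exists (Num.max 0 (M + ln (2 * C))) => [|xi p Lxi p01]; first by rewrite le_max lexx.
have [h Hh hC] := HC xi p Lxi p01; have [x Xx xh] := XM h Hh; exists x => //.
have pb := ray_ball (LS _ Lxi) p01.
have hb := hull_ball LS Hh; have xb := hull_ball LS (XH _ Xx).
apply: (le_trans (hdist_triangle xb hb pb)); rewrite le_max; apply/orP; right.
by apply: lerD => //; rewrite hdistC; exact: (hdist_le_ln pb hb hC).
Qed.

(** Here [(1 - r) *: xi] is the top of a shadow of radius about [r] around [xi], and [x] lies deeper
    over that shadow. Their Euclidean distance is [O(r)], so [ch] between them is at most of order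
    [r / (1 - enorm x)], that is [r * expR (hdist x 0)]. *)
Lemma shadow_dist (B : R) : 0 <= B -> exists D : R,
  forall x xi xi' (r : R), unit_ball x -> sqnorm xi = 1 -> x != 0 ->
    enorm ((enorm x)^-1 *: x - xi') <= 2 * (1 - enorm x) ->
    enorm (xi' - xi) <= B * r -> 0 < r <= 1 -> 1 - enorm x <= r ->
    hdist x ((1 - r) *: xi) <= hdist x 0 + ln r + D.
Proof.
(* In units of [r], the factor [4 + B] adds up the radial move of [x] to the sphere, at most 1, the
   chord to [xi'], at most 2, the chord on to [xi], at most [B], and the radial move down from [xi],
   which is 1. *)
move=> B0; set C := 1 + 2 * (4 + B) ^+ 2; exists (ln (4 * C)).
have C1 : 1 <= C by rewrite lerDl mulr_ge0 // sqr_ge0.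
move=> x xi xi' r xb xi1 x0 xxi' xixi /andP[r0 r1] xr.
have n1 : enorm x < 1 by rewrite enorm_lt1.
have n0 : 0 < enorm x by apply: enorm_gt0; exact/eqP.
have u0 : 0 < 1 - enorm x by rewrite subr_gt0.
have p01 : 0 <= 1 - r < 1 by apply/andP; split; lra.
have pb := ray_ball xi1 p01.
have exi : enorm xi = 1 by rewrite /enorm xi1 sqrtr1.
have dx : enorm (x - (1 - r) *: xi) <= (4 + B) * r.
  apply: (le_trans (enorm_triangle ((enorm x)^-1 *: x) _ _)).
  have -> : x - (enorm x)^-1 *: x = (1 - (enorm x)^-1) *: x by rewrite scalerBl scale1r.
  have -> : enorm ((1 - (enorm x)^-1) *: x) = 1 - enorm x.
    rewrite enormZ ler0_norm; last by rewrite subr_le0 invf_ge1 // ltW.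
    by field; rewrite gt_eqF.
  have h1 := enorm_triangle xi' ((enorm x)^-1 *: x) ((1 - r) *: xi).
  have h2 := enorm_triangle xi xi' ((1 - r) *: xi).
  have h3 : enorm (xi - (1 - r) *: xi) = r.
    have -> : xi - (1 - r) *: xi = r *: xi by rewrite scalerBl scale1r opprB addrC subrK.
    by rewrite enormZ exi mulr1 gtr0_norm.
  lra.
have bound : ch x ((1 - r) *: xi) <= 2 * C * r * expR (hdist x 0).
  apply: (@le_trans _ _ (2 * C * r * ch x 0)); last first.
    rewrite ler_wpM2l //; last exact: exp_hdist_ge unit_ball0.
    by rewrite !mulr_ge0 //; lra.
  apply: (@le_trans _ _ (C * r / (1 - enorm x))); last first.
    have [h _] := ch0_bounds xb.
    have -> : C * r / (1 - enorm x) = 2 * C * r * (2 * (1 - enorm x))^-1.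
      by field; rewrite gt_eqF.
    by rewrite ler_wpM2l // !mulr_ge0 //; lra.
  rewrite /ch sqnormZ xi1 mulr1 -!sqr_enorm.
  rewrite -(ler_pM2r u0) divfK ?gt_eqF //.
  move: dx; have := enorm_ge0 (x - (1 - r) *: xi).
  move: (enorm (x - _)) (enorm x) n0 n1 u0 xr => d a a0 a1 u0 ar d0 dB.
  have w0 : 0 < (1 - a ^+ 2) * (1 - (1 - r) ^+ 2).
    by rewrite mulr_gt0 //; nra.
  have w1 : (1 - a) * r <= (1 - a ^+ 2) * (1 - (1 - r) ^+ 2).
    by apply: ler_pM; nra.
  have dd : d ^+ 2 <= ((4 + B) * r) ^+ 2 by rewrite ler_pXn2r ?nnegrE // mulr_ge0 // ?ltW //; lra.
  have q : 2 * d ^+ 2 / ((1 - a ^+ 2) * (1 - (1 - r) ^+ 2)) * (1 - a) <= 2 * (4 + B) ^+ 2 * r.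
    rewrite mulrAC ler_pdivrMr //.
    have E0 : 0 <= 2 * (4 + B) ^+ 2 * r by apply: mulr_ge0; [apply: mulr_ge0; [by []|exact: sqr_ge0]|exact: ltW].
    apply: le_trans (ler_wpM2l E0 w1).
    have -> : 2 * (4 + B) ^+ 2 * r * ((1 - a) * r) = 2 * ((4 + B) * r) ^+ 2 * (1 - a) by ring.
    by rewrite ler_pM2r // ler_pM2l.
  have -> : C * r = r + 2 * (4 + B) ^+ 2 * r by rewrite /C; ring.
  by rewrite [leLHS]mulrDl mul1r; apply: lerD.
apply: (le_trans (hdist_le_ln xb pb bound)).
have -> : 2 * (2 * C * r * expR (hdist x 0)) = 4 * C * r * expR (hdist x 0) by ring.
have C4 : 0 < 4 * C by lra.
rewrite lnM ?posrE ?expR_gt0 ?(mulr_gt0 C4) // expRK lnM ?posrE //.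
lra.
Qed.

End Shadows.

Section BoundedType.
Context {R : realType} {n : nat}.
Local Notation k := n.+1.
Implicit Types (x y z xi : 'rV[R]_k) (A X Lambda : set 'rV[R]_k) (t : seq 'rV[R]_k).

(** Meant for finite [A]; an infinite set gets the value [0]. *)
Definition cnt A : nat := size (fset_set A).

Lemma le_cnt A t : finite_set A -> uniq t -> {in t, forall x, A x} -> (size t <= cnt A)%N.
Proof.
move=> finA ut tA; apply: uniq_leq_size => // x /tA Ax.
by rewrite in_fset_set // mem_set.
Qed.

Lemma countingE A : finite_set A -> counting A = (cnt A)%:R%:E :> \bar R.
Proof. by move=> finA; rewrite /counting asboolT. Qed.

Lemma hball_eq0 z (r : R) : unit_ball z -> r <= 0 -> hball z r = set0.
Proof.
move=> zb r0; apply/seteqP; split => // x [xb]; rewrite ltNge => /negP; apply.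
exact: le_trans r0 (hdist_ge0 xb zb).
Qed.

Lemma bounded_type_cnt X : X `<=` unit_ball ->
  (forall z r, unit_ball z -> finite_set (X `&` hball z r)) -> bounded_type X ->
  exists x0 (rho : R), [/\ X x0, 1 <= rho & forall x r, X x ->
    (cnt (X `&` hball x r))%:R <= rho * (cnt (X `&` hball x0 r))%:R].
Proof.
move=> XB finX [x0 Xx0 [rho rho1 H]]; exists x0, rho; split => // x r Xx.
have [r0|r0] := leP r 0.
  by rewrite !hball_eq0 ?setI0 //; [rewrite /cnt fset_set0 mulr0|exact: XB|exact: XB].
have := H x r Xx r0; by rewrite !countingE; [rewrite lee_fin|apply: finX; exact: XB|apply: finX; exact: XB].
Qed.

(** The pairs in [s] are centres and radii of caps covering [Lambda]. A point of [X] far from the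
    origin lies over one of them, hence in a ball of shortened radius about a point [f p] of [X]
    near the top of that cap; bounded type replaces this ball by one about [x0]. The points near the
    origin go into [A]. *)
Lemma shadow_count Lambda X x0 (rho B : R) : Lambda `<=` unit_sphere ->
  uniformly_distributed (hhull Lambda) X -> X x0 -> 0 <= B -> 0 <= rho ->
  (forall z r, unit_ball z -> finite_set (X `&` hball z r)) ->
  (forall x r, X x -> (cnt (X `&` hball x r))%:R <= rho * (cnt (X `&` hball x0 r))%:R) ->
  exists D : R, forall s : seq ('rV[R]_k * R),
    {in s, forall p, Lambda p.1 /\ 0 < p.2 <= 1} ->
    (forall xi, Lambda xi -> exists2 p, p \in s & enorm (xi - p.1) <= B * p.2) ->
    exists2 A : R, 0 <= A & forall r,
      (cnt (X `&` hball x0 r))%:R <=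
        A + rho * \sum_(p <- s) (cnt (X `&` hball x0 (r + (ln p.2 + D))))%:R.
Proof.
move=> LS XU Xx0 B0 rho0 finX bX.
have XH : X `<=` hhull Lambda by case: XU.
have XB : X `<=` unit_ball by move=> x /XH; exact: hull_ball.
have [D1 D10 near] := uniformly_distributed_near_rays LS XU (ex_intro _ x0 Xx0).
have [D2 shadow] := @shadow_dist R n B B0.
have [f Hf] : exists f : 'rV[R]_k * R -> 'rV[R]_k, forall p, Lambda p.1 /\ 0 < p.2 <= 1 ->
    X (f p) /\ hdist (f p) ((1 - p.2) *: p.1) <= D1.
  suff /choice[f Hf] : forall p : 'rV[R]_k * R, exists y, Lambda p.1 /\ 0 < p.2 <= 1 ->
      X y /\ hdist y ((1 - p.2) *: p.1) <= D1 by exists f.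
  move=> p.
  have [[Lp /andP[p0 p1]]|np] := pselect (Lambda p.1 /\ 0 < p.2 <= 1); last by exists 0.
  have p01 : 0 <= 1 - p.2 < 1 by apply/andP; split; lra.
  by have [y Xy yD] := near _ _ Lp p01; exists y.
have z0 := @unit_ball0 R n.
exists (hdist x0 0 + D1 + D2) => s sP cov.
(* Every [p.2^-1] is at most [S], so that a point outside the ball of radius [T] about [x0]
   satisfies [1 - enorm x <= p.2] for all [p] in [s]. *)
pose S := \sum_(p <- s) `|p.2^-1|.
have S0 : 0 <= S by apply: sumr_ge0.
pose T := ln (2 * (S + 1)) + hdist 0 x0 + 1.
exists (cnt (X `&` hball x0 T))%:R => // r.
have x0b := XB _ Xx0.
set t := fset_set (X `&` hball x0 r) : seq _.
have tP x : x \in t -> X x /\ hball x0 r x.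
  by rewrite /t in_fset_set => [/set_mem|]; [|exact: finX].
have ut : uniq t by exact: fset_uniq.
pose P0 x := hdist x x0 < T.
pose P p x := hdist x (f p) < r + (ln p.2 + (hdist x0 0 + D1 + D2)).
have C0 : (count P0 t <= cnt (X `&` hball x0 T))%N.
  rewrite -size_filter; apply: le_cnt; [exact: finX|exact: filter_uniq|].
  by move=> x; rewrite mem_filter => /andP[xT /tP[Xx [xb _]]].
have CP p : p \in s -> (count (P p) t)%:R <=
    rho * (cnt (X `&` hball x0 (r + (ln p.2 + (hdist x0 0 + D1 + D2)))))%:R.
  move=> ps; have [Xf _] := Hf p (sP p ps); apply: le_trans (bX _ _ Xf).
  rewrite ler_nat -size_filter; apply: le_cnt; [exact: finX (XB _ Xf)|exact: filter_uniq|].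
  by move=> x; rewrite mem_filter => /andP[xT /tP[Xx [xb _]]].
have all_t : all (fun x => P0 x || has (P^~ x) s) t.
  apply/allP => x xt; have [Xx [xb xr]] := tP x xt; apply/orP.
  have far c : ch x 0 <= c -> c <= S + 1 -> P0 x.
    move=> xc cS; rewrite /P0 /T.
    have := hdist_le_ln xb z0 (le_trans xc cS); have := hdist_triangle xb z0 x0b; lra.
  have [x_0|x_0] := eqVneq x 0.
    by left; apply: (far 1); [rewrite x_0 chxx|rewrite lerDr].
  have [/hasP[p ps xp]|/hasPn xs] := boolP (has (fun p => p.2 < 1 - enorm x) s).
    left; have [_ h] := ch0_bounds xb; apply: (far _ h).
    have [_ /andP[p0 _]] := sP p ps.
    apply: (@le_trans _ _ (p.2^-1)); first by rewrite lef_pV2 ?posrE ?ltW // (lt_trans p0).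
    rewrite /S (big_rem p) //= gtr0_norm ?invr_gt0 //.
    by rewrite -addrA lerDl addr_ge0 // sumr_ge0.
  right; have [xi Lxi xxi] := hull_shadow LS (XH _ Xx) x_0.
  have [p ps xip] := cov xi Lxi; apply/hasP; exists p => //.
  have [Lp p01] := sP p ps; have [Xf fD] := Hf p (conj Lp p01).
  have px := xs p ps; rewrite -leNgt in px.
  have h := shadow x p.1 xi p.2 xb (LS _ Lp) x_0 xxi xip p01 px.
  have pb : unit_ball ((1 - p.2) *: p.1).
    by apply: ray_ball; [exact: LS|case/andP: p01 => h1 h2; apply/andP; split; lra].
  have := hdist_triangle xb pb (XB _ Xf); rewrite (hdistC ((1 - p.2) *: p.1)).
  have := hdist_triangle xb x0b z0; rewrite /P; lra.
have := size_le_count all_t; rewrite -(ler_nat R) natrD => /le_trans; apply.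
apply: lerD; first by rewrite ler_nat.
rewrite natr_sum mulr_sumr big_seq [leRHS]big_seq; apply: ler_sum => p ps; exact: CP.
Qed.

Lemma critical_exponent_le X z (s : R) : 0 < s ->
  (\esum_(x in X) (expR (- (s * hdist x z)))%:E < +oo)%E -> critical_exponent X z <= s.
Proof.
move=> s0 h; apply: ge_inf => //.
by exists 0 => y [/ltW].
Qed.

Lemma finite_cover_bound Lambda X z (B : R) : Lambda `<=` unit_sphere ->
  uniformly_distributed (hhull Lambda) X -> bounded_type X -> unit_ball z ->
  0 <= B -> 0 < critical_exponent X z ->
  exists c r0 : R, [/\ 0 < c, 0 < r0 & forall s : seq ('rV[R]_k * R),
    {in s, forall p, Lambda p.1 /\ 0 < p.2 <= r0} ->
    (forall xi, Lambda xi -> exists2 p, p \in s & enorm (xi - p.1) <= B * p.2) ->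
    c <= \sum_(p <- s) p.2 `^ (critical_exponent X z)].
Proof.
set Delta := critical_exponent X z.
move=> LS XU Xbt zb B0 D0.
have [XH _ [m m0 msep]] := XU.
have XB : X `<=` unit_ball by move=> x /XH; exact: hull_ball.
have finX z' r : unit_ball z' -> finite_set (X `&` hball z' r).
  by move=> zb'; have [K _ g] := separated_growth XB zb' m0 msep; exact: growth_finite g.
have [x0 [rho [Xx0 rho1 bX]]] := bounded_type_cnt XB finX Xbt.
have rho0 : 0 < rho by apply: lt_le_trans rho1.
have [D HD] := shadow_count LS XU Xx0 B0 (ltW rho0) finX bX.
have x0b := XB _ Xx0.
(* The radius bound makes every shift [ln p.2 + D] at most [-1], as [renewal_growth] requires; a sum
   below the constant makes [rho] times the sum of [expR (Delta * (ln p.2 + D))] less than [1]. *)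
exists (rho * expR (Delta * D))^-1, (Num.min 1 (expR (- 1 - D))).
split; first by rewrite invr_gt0 mulr_gt0 // expR_gt0.
  by rewrite lt_min ltr01 expR_gt0.
move=> s sP cov.
have p0 p : p \in s -> 0 < p.2 by move=> /sP[_ /andP[]].
rewrite leNgt; apply/negP => small.
have sP1 : {in s, forall p, Lambda p.1 /\ 0 < p.2 <= 1}.
  by move=> p /sP[Lp /andP[-> p1]]; split => //=; apply: le_trans p1 _; rewrite ge_min lexx.
have [A A0 rec] := HD s sP1 cov.
pose bs := [seq ln p.2 + D | p <- s].
have sum1 : rho * (\sum_(b <- bs) expR (Delta * b)) < 1.
  rewrite /bs big_map.
  rewrite (_ : \sum_(p <- s) expR (Delta * (ln p.2 + D)) =
     (\sum_(p <- s) p.2 `^ Delta) * expR (Delta * D)).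
    by rewrite mulrCA -ltr_pdivlMr ?mulr_gt0 ?expR_gt0 // div1r.
  rewrite mulr_suml big_seq [RHS]big_seq; apply: eq_bigr => p /p0 pp.
  by rewrite mulrDr expRD /powR gt_eqF.
have [sigma [s0 sD sum2]] := lower_exponent D0 (ltW rho0) sum1.
have [K K0 HK] : exists2 K, 0 <= K & forall r, (cnt (X `&` hball x0 r))%:R <= K * expR (sigma * r).
  apply: (@renewal_growth R (fun r => (cnt (X `&` hball x0 r))%:R) A rho sigma bs) => //.
  - by move=> r r0; rewrite hball_eq0 // setI0 /cnt fset_set0.
  - exact: ltW.
  - by move=> r; rewrite /bs big_map; exact: rec.
  - move=> b /mapP[p ps ->]; have [_ /andP[pp]] := sP p ps; rewrite le_min => /andP[_ pD].
    have : ln p.2 <= - 1 - D by rewrite -(expRK (- 1 - D)) ler_ln ?posrE ?expR_gt0.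
    lra.
have g0 : growth X x0 sigma K.
  move=> r t ut tX; apply: le_trans (HK r); rewrite ler_nat.
  by apply: le_cnt => //; exact: finX.
have g := growth_base XB x0b zb K0 s0 g0.
have KK : 0 <= K * expR (sigma * hdist x0 z) by rewrite mulr_ge0 // expR_ge0.
pose s' := (sigma + Delta) / 2.
have s's : sigma < s' by rewrite /s'; lra.
have := critical_exponent_le (le_lt_trans s0 s's) (growth_esum XB zb KK s0 s's g).
rewrite -/Delta /s'; lra.
Qed.

End BoundedType.

(** * Hausdorff measure *)

Lemma sin_MVT {R : realType} (x : R) : 0 < x -> exists2 c, 0 < c < x & sin x = cos c * x.
Proof.
move=> x0; have [|c] := @MVT R sin cos 0 x x0 (fun y _ => is_derive_sin y).
  by apply: continuous_subspaceT => y; exact: continuous_sin.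
by rewrite in_itv /= sin0 !subr0 => c0x e; exists c.
Qed.

Section Spherical.
Context {R : realType} {k : nat}.
Implicit Types (x y : 'rV[R]_k) (U : set 'rV[R]_k).

Lemma sphere_dot_itv x y : unit_sphere x -> unit_sphere y -> -1 <= dotv x y <= 1.
Proof.
move=> x1 y1; have := sqnorm_ge0 (x + y); have := sqnorm_ge0 (x - y).
by rewrite sqnormB sqnormD x1 y1 => h1 h2; apply/andP; split; lra.
Qed.

Lemma sdistxx x : unit_sphere x -> sdist x x = 0.
Proof. by move=> x1; rewrite /sdist -/(sqnorm x) x1 acos1. Qed.

Lemma sdist_ge0 x y : unit_sphere x -> unit_sphere y -> 0 <= sdist x y.
Proof. by move=> x1 y1; rewrite /sdist acos_ge0 // sphere_dot_itv. Qed.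

Lemma enorm_sdist x y : unit_sphere x -> unit_sphere y ->
  enorm (x - y) = 2 * sin (sdist x y / 2).
Proof.
move=> x1 y1; have xy := sphere_dot_itv x1 y1.
have s0 : 0 <= sin (sdist x y / 2).
  apply: sin_ge0_pi; have := acos_ge0 xy; have := acos_lepi xy; have := pi_ge0 R.
  by rewrite -/(sdist x y) => h1 h2 h3; apply/andP; split; lra.
apply: (@pexpIrn _ 2) => //; rewrite ?nnegrE ?enorm_ge0 ?mulr_ge0 //.
rewrite sqr_enorm exprMn sin2cos2 sqnormB x1 y1.
have -> : dotv x y = cos (sdist x y) by rewrite /sdist acosK // in_itv.
have -> : cos (sdist x y) = cos ((sdist x y / 2) *+ 2) by congr cos; rewrite mulr2n; field.
by rewrite cos_mulr2n mulr2n; ring.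
Qed.

Lemma enorm_le_sdist x y : unit_sphere x -> unit_sphere y -> enorm (x - y) <= sdist x y.
Proof.
move=> x1 y1; rewrite enorm_sdist //; have := sdist_ge0 x1 y1.
rewrite le_eqVlt => /predU1P[<-|h]; first by rewrite mul0r sin0 mulr0.
have h2 : 0 < sdist x y / 2 by lra.
have [c _ ->] := sin_MVT h2; have := cos_le1 c; nra.
Qed.

Lemma sdist_le_enorm x y : unit_sphere x -> unit_sphere y -> enorm (x - y) <= 1 ->
  sdist x y <= 2 * enorm (x - y).
Proof.
move=> x1 y1; rewrite enorm_sdist // => h1; have := sdist_ge0 x1 y1.
have := acos_lepi (sphere_dot_itv x1 y1); rewrite -/(sdist x y) => hpi.
rewrite le_eqVlt => /predU1P[<-|h]; first by rewrite mul0r sin0 !mulr0.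
have h2 : 0 < sdist x y / 2 by lra.
set phi := sdist x y / 2 in h1 h2 *.
have [c /andP[c0 cp] e] := sin_MVT h2.
have phi_pi : phi <= pi / 2 by rewrite /phi; lra.
(* This follows from [sin phi <= 2^-1]; as [cos] decreases, it bounds the derivative in the mean
   value formula from below by [2^-1]. *)
have cosphi : 2^-1 <= cos phi.
  have cp0 : 0 <= cos phi by apply: cos_ge0_pihalf; apply/andP; split; lra.
  have s0 : 0 <= sin phi by apply: sin_ge0_pi; apply/andP; split; lra.
  have := cos2Dsin2 phi; nra.
have cc : cos phi <= cos c.
  by apply: ltW; rewrite ltr_cos // in_itv /=; apply/andP; split; lra.
have -> : sdist x y = 2 * phi by rewrite /phi; field.
rewrite e ler_pM2l // mulrA -[leLHS]mul1r ler_pM2r //; lra.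
Qed.

Lemma sdiam_ge U x y : U x -> U y -> ((sdist x y)%:E <= sdiam U)%E.
Proof. by move=> Ux Uy; apply: ereal_sup_ubound; exists (x, y). Qed.

Lemma sdiam_ge0 U : U `<=` unit_sphere -> U !=set0 -> (0 <= sdiam U)%E.
Proof. by move=> US [x Ux]; have := sdiam_ge Ux Ux; rewrite sdistxx //; exact: US. Qed.

Lemma diam_pow_ge0 (s : R) U : (0 <= diam_pow s U)%E.
Proof. by rewrite /diam_pow; case: ifP => // _; exact: poweR_ge0. Qed.

End Spherical.

Lemma ler_sum_fset {R : realDomainType} (D : {fset nat}) (F : nat -> R) (J : nat) :
  (forall i, 0 <= F i) -> (forall i, i \in D -> (i < J)%N) ->
  \sum_(i <- D) F i <= \sum_(0 <= i < J) F i.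
Proof.
move=> F0 DJ; rewrite (perm_big [seq i <- index_iota 0 J | i \in D]) /=; last first.
  apply: uniq_perm; [exact: fset_uniq|by rewrite filter_uniq // iota_uniq|].
  move=> i; rewrite mem_filter mem_index_iota /=.
  by case: (boolP (i \in D)) => // /DJ ->.
by rewrite big_filter big_mkcond; apply: ler_sum => i _; case: ifP.
Qed.

Lemma sum_half_lt1 {R : realFieldType} (J : nat) : \sum_(0 <= i < J) 2^-1 ^+ i.+1 <= 1 :> R.
Proof.
have -> : \sum_(0 <= i < J) 2^-1 ^+ i.+1 = 1 - 2^-1 ^+ J :> R.
  elim: J => [|J IH]; first by rewrite big_nil subrr.
  by rewrite big_nat_recr //= IH !exprS; field.
by rewrite gerBl exprn_ge0 // invr_ge0.
Qed.

Lemma sphere_compact {R : realType} {n : nat} (Lambda : set 'rV[R]_n.+1) :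
  Lambda `<=` unit_sphere -> closed Lambda -> compact Lambda.
Proof.
move=> LS Lc; apply: bounded_closed_compact => //.
exists 1; split; first exact: num_real.
move=> M M1 x /LS x1; rewrite /Num.Def.normr /= mx_normrE; apply/bigmax_leP; split; first by rewrite ltW // (lt_trans ltr01).
case=> i j _ /=; rewrite ord1; apply: le_trans (ltW M1).
rewrite -(@ler_pXn2r _ 2) ?nnegrE // expr1n real_normK ?num_real //.
by apply: le_trans (sqnorm_coord x j) _; rewrite x1.
Qed.

Section Hausdorff.
Context {R : realType} {n : nat}.
Local Notation k := n.+1.
Implicit Types (x y xi : 'rV[R]_k) (Lambda : set 'rV[R]_k) (U : nat -> set 'rV[R]_k).

(** With exponent [0], any nonempty set of a cover counts as [1], even when its diameter is [0]. *)
Lemma hausdorff_measure_gt0_nonempty Lambda : Lambda !=set0 ->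
  (0 < hausdorff_measure 0 Lambda)%E.
Proof.
move=> [xi Lxi]; apply: (@lt_le_trans _ _ 1%E) => //.
apply: le_ereal_sup_tmp; exists (hausdorff_premeasure 0 1 Lambda); first by exists 1; [exact: ltr01|].
apply: le_ereal_inf_tmp => _ [U [_ cov] <-].
have [i _ Ui] := cov xi Lxi.
apply: (@le_trans _ _ (\sum_(0 <= j < i.+1) diam_pow 0 (U j))%E); last first.
  by apply: nneseries_lim_ge => j _ _; exact: diam_pow_ge0.
rewrite big_nat_recr //=.
have -> : diam_pow 0 (U i) = 1%E.
  by rewrite /diam_pow ifF ?poweRe0 //; apply/negP => /eqP U0; rewrite U0 in Ui.
by rewrite leeDr // sume_ge0 // => j _; exact: diam_pow_ge0.
Qed.

Lemma powR_rootK (a s : R) : 0 <= a -> 0 < s -> (a `^ s^-1) `^ s = a.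
Proof. by move=> a0 s0; rewrite -powRrM mulVf ?gt_eqF // powRr1. Qed.

Lemma powR_Kroot (a s : R) : 0 <= a -> 0 < s -> (a `^ s) `^ s^-1 = a.
Proof. by move=> a0 s0; rewrite -powRrM mulfV ?gt_eqF // powRr1. Qed.

(* Enlarging the sets of a countable cover to open balls, at an arbitrarily
   small cost, makes the cover finite by compactness. *)
Lemma hausdorff_measure_gt0 Lambda (Delta c r0 : R) :
  Lambda `<=` unit_sphere -> closed Lambda -> 0 < Delta -> 0 < c -> 0 < r0 ->
  (forall s : seq ('rV[R]_k * R),
    {in s, forall p, Lambda p.1 /\ 0 < p.2 <= r0} ->
    (forall xi, Lambda xi -> exists2 p, p \in s & enorm (xi - p.1) <= k%:R * p.2) ->
    c <= \sum_(p <- s) p.2 `^ Delta) ->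
  (0 < hausdorff_measure Delta Lambda)%E.
Proof.
move=> LS Lc D0 c0 r00 H.
have iD0 : 0 < Delta^-1 by rewrite invr_gt0.
have rD : 0 < r0 `^ Delta / 2 by rewrite divr_gt0 // powR_gt0.
(* A set of diameter at most [delta] contributes at most half of the [Delta]-th power of [r0]; the
   other half is left for the enlargement [eta], so that the radii [r i] are at most [r0]. *)
pose delta := (r0 `^ Delta / 2) `^ Delta^-1.
have delta0 : 0 < delta by exact: powR_gt0.
pose eta := Num.min (c / 2) (r0 `^ Delta / 2).
have eta0 : 0 < eta by rewrite lt_min rD andbT divr_gt0.
have eta1 : eta <= c / 2 by rewrite ge_min lexx.
have eta2 : eta <= r0 `^ Delta / 2 by rewrite ge_min lexx orbT.
apply: (@lt_le_trans _ _ (c / 2)%:E); first by rewrite lte_fin divr_gt0.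
apply: le_ereal_sup_tmp; exists (hausdorff_premeasure Delta delta Lambda); first by exists delta.
apply: le_ereal_inf_tmp => _ [U [Uok cov] <-].
rewrite leNgt; apply/negP => small.
pose F i := fine (diam_pow Delta (U i)).
have F0 i : 0 <= F i by rewrite fine_ge0 // diam_pow_ge0.
have [d Hd] : exists d : nat -> R, forall i, U i !=set0 ->
    [/\ 0 <= d i, d i <= delta, sdiam (U i) = (d i)%:E & F i = d i `^ Delta].
  exists (fun i => fine (sdiam (U i))) => i Ui.
  have [US Ud] := Uok i; have s0 := sdiam_ge0 US Ui.
  have sf : sdiam (U i) \is a fin_num.
    by rewrite ge0_fin_numE // (le_lt_trans Ud) // ltry.
  split; [exact: fine_ge0|by rewrite -lee_fin fineK|by rewrite fineK|].
  by rewrite /F /diam_pow ifF ?fine_poweR //; apply/negP => /eqP; apply/eqP/set0P.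
have FE i : diam_pow Delta (U i) = (F i)%:E.
  rewrite /F fineK //; rewrite /diam_pow; case: ifP => // /negbT/set0P/Hd[_ _ -> _].
  by rewrite poweR_EFin.
(* The enlargement is geometric in [i], with total at most [eta], and makes the radius positive even
   for a set reduced to a point. *)
pose e i := F i + eta * 2^-1 ^+ i.+1.
have e0 i : 0 < e i by rewrite /e ltr_wpDl // mulr_gt0 // exprn_gt0 // invr_gt0.
pose r i := e i `^ Delta^-1.
have r_gt0 i : 0 < r i by exact: powR_gt0.
have rE i : r i `^ Delta = e i by rewrite powR_rootK // ltW.
have dr i : U i !=set0 -> d i < r i.
  move=> /Hd[d0 _ _ Fi]; rewrite -(powR_Kroot d0 D0) /r gt0_ltr_powR ?nnegrE ?powR_ge0 ?(ltW (e0 i)) //.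
  by rewrite -Fi ltrDl mulr_gt0 // exprn_gt0 // invr_gt0.
have rr0 i : U i !=set0 -> r i <= r0.
  move=> /Hd[d0 dd _ Fi]; rewrite -(powR_Kroot (ltW r00) D0) /r.
  apply: ge0_ler_powR; rewrite ?nnegrE ?powR_ge0 ?(ltW (e0 i)) ?(ltW iD0) //.
  have : F i <= r0 `^ Delta / 2.
    rewrite Fi -(powR_rootK (ltW rD) D0).
    by apply: ge0_ler_powR; rewrite ?nnegrE ?(ltW D0) // ltW.
  have : eta * 2^-1 ^+ i.+1 <= eta.
    by rewrite -[leRHS]mulr1 ler_wpM2l ?(ltW eta0) // exprn_ile1 // ?invr_ge0 // invf_le1 // ler1n.
  rewrite /e; lra.
(* Only the sets meeting [Lambda] are kept, so that the centres [xi i] can be taken in [Lambda]. *)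
pose I := [set i | (U i `&` Lambda) !=set0].
have [xi Hxi] : exists xi : nat -> 'rV[R]_k, forall i, I i -> (U i `&` Lambda) (xi i).
  suff /choice[xi Hxi] : forall i, exists x, I i -> (U i `&` Lambda) x by exists xi.
  by move=> i; have [[x Ux]|ni] := pselect (I i); [exists x|exists 0].
have Lcpt := sphere_compact LS Lc; rewrite compact_cover in Lcpt.
have [||D' D'I D'cov] := Lcpt nat I (fun i => ball (xi i) (r i)).
- by move=> i _; exact: ball_open.
- move=> y Ly; have [i _ Uy] := cov y Ly.
  have Ii : I i by exists y.
  have [Uxi Lxi] := Hxi i Ii; exists i => //.
  split => // a b; rewrite /ball /= ord1.
  have [_ _ sd _] := Hd i (ex_intro _ y Uy).
  apply: (@le_lt_trans _ _ (d i)); last by apply: dr; exists y.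
  have : (sdist (xi i) y <= d i) by rewrite -lee_fin -sd; exact: sdiam_ge.
  apply: le_trans; apply: le_trans (enorm_le_sdist (LS _ Lxi) (LS _ Ly)).
  rewrite -(@ler_pXn2r _ 2) ?nnegrE ?enorm_ge0 // sqr_enorm real_normK ?num_real //.
  by have := sqnorm_coord (xi i - y) b; rewrite !mxE.
have D'I' i : i \in D' -> I i by move=> /D'I/set_mem.
have := H [seq (xi i, r i) | i <- D'].
have -> : \sum_(p <- [seq (xi i, r i) | i <- D']) p.2 `^ Delta = \sum_(i <- D') e i.
  by rewrite big_map; apply: eq_bigr => i _; exact: rE.
move=> H1; suff: c <= \sum_(i <- D') e i.
  have [J DJ] : exists J, forall i, i \in D' -> (i < J)%N.
    exists (\max_(i <- D') i.+1)%N => i iD.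
    by rewrite (leq_bigmax_seq _ iD).
  have eJ := ler_sum_fset (fun i => ltW (e0 i)) DJ.
  have eS : \sum_(0 <= i < J) e i =
      \sum_(0 <= i < J) F i + eta * \sum_(0 <= i < J) 2^-1 ^+ i.+1.
    by rewrite mulr_sumr -big_split.
  have hJ : eta * \sum_(0 <= i < J) 2^-1 ^+ i.+1 <= eta.
    by rewrite -[leRHS]mulr1 ler_wpM2l ?sum_half_lt1 // ltW.
  have FJ : \sum_(0 <= i < J) F i < c / 2.
    rewrite -lte_fin -sumEFin; apply: le_lt_trans small.
    under eq_bigr do rewrite -FE.
    by apply: nneseries_lim_ge => j _ _; exact: diam_pow_ge0.
  lra.
apply: H1 => [p /mapP[i iD ->]|y Ly] /=.
  have [Ui Lxi] := Hxi i (D'I' i iD); split => //; rewrite r_gt0 /=.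
  by apply: rr0; exists (xi i).
have [i iD [_ yi]] := D'cov y Ly; exists (xi i, r i) => /=.
  by apply/mapP; exists i.
(* Here [ball] is a sup-norm ball, hence the factor [k] in the covering hypothesis. *)
apply: enorm_vcube; first exact: ltW.
by move=> j; have := yi 0 j; rewrite /ball /= distrC.
Qed.

End Hausdorff.

(** * Dimensions *)

Section ExtendedReals.
Context {R : realType}.
Local Open Scope ereal_scope.

Lemma ereal_dense (x y : \bar R) : x < y -> exists r : R, x < r%:E < y.
Proof.
case: x => [x| |]; case: y => [y| |] //=; rewrite ?lte_fin => xy.
- by exists ((x + y) / 2)%R; rewrite !lte_fin; apply/andP; split; lra.
- by exists (x + 1)%R; rewrite ltry lte_fin andbT; lra.
- by exists (y - 1)%R; rewrite ltNyr lte_fin /=; lra.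
- by exists 0%R; rewrite ltNyr ltry.
Qed.

Lemma lee_by_reals (x y : \bar R) :
  (forall s e : R, x < s%:E -> (0 < e)%R -> y <= (s + e)%:E) -> y <= x.
Proof.
move=> H; rewrite leNgt; apply/negP => /[dup] xy /ereal_dense[r /andP[xr ry]].
have [r' /andP[rr' ry']] := ereal_dense ry; rewrite lte_fin in rr'.
have := H r (r' - r)%R xr; rewrite subr_gt0 => /(_ rr').
by rewrite addrC subrK leNgt ry'.
Qed.

Lemma lne_le (v : \bar R) (t : R) : (lne v <= t%:E) = (v <= (expR t)%:E).
Proof.
have [v0|v0] := leP v 0; last first.
  by rewrite -lee_expeR lneK // in_itv /= leey ltW.
by rewrite le0_lneNy // leNye (le_trans v0) // lee_fin expR_ge0.
Qed.

Lemma limf_esup_lt (T : choiceType) (X : filteredType T) (f : X -> \bar R)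
    (F : set_system X) (a : \bar R) :
  limf_esup f F < a -> exists2 V, F V & forall x, V x -> f x <= a.
Proof.
move=> /ereal_inf_lt[_ [V FV <-]] Va; exists V => // x Vx.
by apply: (le_trans _ (ltW Va)); apply: ereal_sup_ubound; exists x.
Qed.

Lemma limf_esup_le (T : choiceType) (X : filteredType T) (f : X -> \bar R)
    (F : set_system X) (V : set X) (a : \bar R) :
  F V -> (forall x, V x -> f x <= a) -> limf_esup f F <= a.
Proof.
move=> FV Va; apply: (@le_trans _ _ (ereal_sup (f @` V))).
  by apply: ereal_inf_lbound; exists V.
by apply: ge_ereal_sup => _ [x Vx <-]; exact: Va.
Qed.

Lemma limf_einf_lt (T : choiceType) (X : filteredType T) (f : X -> \bar R)
    (F : set_system X) (V : set X) (a : \bar R) :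
  F V -> limf_einf f F < a -> exists2 x, V x & f x < a.
Proof.
move=> FV fa; have : ereal_inf (f @` V) < a.
  apply: le_lt_trans fa; rewrite limf_einfE; apply: ereal_sup_ubound.
  by exists V.
by move=> /ereal_inf_lt[_ [x Vx <-] xa]; exists x.
Qed.

Lemma limf_einf_le_esup (T : choiceType) (X : filteredType T) (f : X -> \bar R)
    (F : set_system X) : ProperFilter F -> limf_einf f F <= limf_esup f F.
Proof.
move=> FF; rewrite leNgt; apply/negP => h.
have [a /andP[ea ae]] := ereal_dense h.
have [V FV Va] := limf_esup_lt ea.
move: ae; rewrite ltNge => /negP; apply.
rewrite limf_einfE; apply: ge_ereal_sup => _ [W FW <-].
have [x [Vx Wx]] := @filter_ex _ F FF _ (filterI FV FW).
by apply: le_trans (Va x Vx); apply: ereal_inf_lbound; exists x.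
Qed.

End ExtendedReals.

Section Dimensions.
Context {R : realType} {k : nat}.
Implicit Types (A U : set 'rV[R]_k).

Lemma covering_number_ge1 A (delta : R) : A !=set0 -> (1 <= covering_number delta A)%E.
Proof.
move=> [x Ax]; apply: le_ereal_inf_tmp => _ [[|N] [U [_ cov]] <-].
  by have [i] := cov x Ax.
by rewrite lee_fin ler1n.
Qed.

Lemma diam_pow_le U (s' delta : R) : U `<=` unit_sphere -> 0 < s' ->
  0 < delta -> (sdiam U <= delta%:E)%E -> (diam_pow s' U <= (delta `^ s')%:E)%E.
Proof.
move=> US s0 d0 Ud; rewrite /diam_pow; case: ifP => [_|/negbT/set0P U0].
  by rewrite lee_fin powR_ge0.
have := sdiam_ge0 US U0; move: (sdiam U) Ud => [d| |] //; rewrite !lee_fin => dd d1.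
by apply: ge0_ler_powR; rewrite ?nnegrE // ltW.
Qed.

Lemma diam_pow_exponent U (s s' : R) : U `<=` unit_sphere -> 0 <= s -> s <= s' ->
  (sdiam U <= 1)%E -> (diam_pow s' U <= diam_pow s U)%E.
Proof.
move=> US s0 ss' U1; rewrite /diam_pow; case: ifP => // /negbT/set0P U0.
have := sdiam_ge0 US U0; move: (sdiam U) U1 => [d| |] //; rewrite !lee_fin => d1 d0.
move: d0; rewrite le_eqVlt => /predU1P[<-|d0].
  move: ss'; rewrite le_eqVlt => /predU1P[<-//|ss'].
  by rewrite [leLHS]powR0 ?powR_ge0 // gt_eqF // (le_lt_trans s0).
by apply: ger_powR => //; rewrite d0.
Qed.

(** For [s' < s] and sets of diameter at most [1] the power with exponent [s] is the smaller one, so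
    a vanishing [s']-measure would force the [s]-measure to vanish. The scale [Num.min delta 1]
    ensures the bound on diameters. *)
Lemma hausdorff_dim_ge A (s : R) : (0 < hausdorff_measure s A)%E -> (s%:E <= hausdorff_dim A)%E.
Proof.
move=> Hs; apply: le_ereal_inf_tmp => _ [s' [s'0 Hs'] <-]; rewrite lee_fin leNgt.
apply/negP => ss'; move: Hs; rewrite ltNge => /negP; apply; rewrite -Hs'.
apply: ge_ereal_sup => _ [delta d0 <-].
apply: le_ereal_sup_tmp; exists (hausdorff_premeasure s' (Num.min delta 1) A).
  by exists (Num.min delta 1) => //=; rewrite lt_min d0 ltr01.
apply: le_ereal_inf_tmp => _ [U [Uok cov] <-].
apply: (@le_trans _ _ (\sum_(0 <= i <oo) diam_pow s (U i))%E).
  apply: ereal_inf_lbound; exists U => //; split => // i; have [US Ud] := Uok i.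
  by split => //; apply: le_trans Ud _; rewrite lee_fin ge_min lexx.
apply: lee_nneseries => i _; first by move=> _; exact: diam_pow_ge0.
have [US Ud] := Uok i; apply: (diam_pow_exponent US) => //; first exact: ltW.
by apply: le_trans Ud _; rewrite lee_fin ge_min lexx orbT.
Qed.

Lemma near_right0 (d : R) : 0 < d -> at_right 0 [set x : R | 0 < x < d].
Proof.
move=> d0; near=> x; apply/andP; split.
  by near: x; exact: nbhs_right_gt.
by near: x; exact: nbhs_right_lt.
Unshelve. all: by end_near. Qed.

(** For [s] above the lower box dimension there are arbitrarily small [d] and covers by at most
    [2 * expR (s * - ln d)] sets of diameter at most [d]. Their sum with exponent [s + e] is at most
    [2 * expR (e * ln d)], which tends to [0] with [d]. *)
Lemma hausdorff_dim_le_lower_box A : A !=set0 -> (hausdorff_dim A <= lower_box_dim A)%E.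
Proof.
move=> A0; apply: lee_by_reals => s e ls e0.
have s0 : 0 < s.
  have [d /andP[d0 d1] ds] := limf_einf_lt (near_right0 ltr01) ls.
  rewrite -lte_fin; apply: le_lt_trans ds.
  rewrite mule_ge0 ?lne_ge0 ?covering_number_ge1 // lee_fin invr_ge0 oppr_ge0.
  by rewrite ln_le0 // ltW.
apply: ereal_inf_lbound; exists (s + e) => //; split; first by rewrite addr_ge0 // ltW.
apply/eqP; rewrite eq_le; apply/andP; split; last first.
  apply: le_ereal_sup_tmp; exists (hausdorff_premeasure (s + e) 1 A).
    by exists 1; [exact: ltr01|].
  by apply: le_ereal_inf_tmp => _ [U _ <-]; apply: nneseries_ge0 => i _ _; exact: diam_pow_ge0.
apply: ge_ereal_sup => _ [delta0 d00 <-].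
apply/lee_addgt0Pr => eta eta0; rewrite add0e.
pose d1 := expR (ln (eta / 2) / e).
have d1_gt0 : 0 < d1 by exact: expR_gt0.
have dm0 : 0 < Num.min (Num.min delta0 1) d1 by rewrite !lt_min d00 ltr01 d1_gt0.
have [d /andP[d0]] := limf_einf_lt (near_right0 dm0) ls.
rewrite !lt_min => /andP[/andP[dd0 d_1] dd1].
have ld : 0 < - ln d by rewrite oppr_gt0 ln_lt0 // d0.
move=> /ltW; rewrite /box_ratio lee_pdivrMr // -EFinM lne_le => cov.
(* The factor [2] gives a strict inequality, so that an actual cover can be drawn from the infimum
   [covering_number]. *)
have [_ [N [U [Uok UA]] <-]] : exists2 y, [set N%:R%:E | N in [set N : nat |
    exists U : nat -> set 'rV[R]_k,
      (forall i, U i `<=` unit_sphere /\ (sdiam (U i) <= d%:E)%E) /\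
      A `<=` \bigcup_(i < N) U i]] y & (y < (2 * expR (s * - ln d))%:E)%E.
  apply: ereal_inf_lt; apply: le_lt_trans cov _; rewrite lte_fin.
  by have := expR_gt0 (s * - ln d); lra.
rewrite lte_fin => Nd.
(* The finite cover is completed to a sequence by empty sets, on which [diam_pow] is [0]. *)
pose V i := if (i < N)%N then U i else set0.
have VE i : (N <= i)%N -> V i = set0 by rewrite /V ltnNge => ->.
have VS i : V i `<=` unit_sphere /\ (sdiam (V i) <= d%:E)%E.
  rewrite /V; case: ifP => _; first exact: Uok.
  by split => //; apply: ge_ereal_sup => _ [[? ?] [[]]].
apply: (@le_trans _ _ (\sum_(0 <= i <oo) diam_pow (s + e) (V i))%E).
  apply: ereal_inf_lbound; exists V => //; split.
    move=> i; have [VSi Vd] := VS i; split => //.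
    by apply: le_trans Vd _; rewrite lee_fin ltW.
  by move=> x /UA[i /= iN Ui]; exists i => //; rewrite /V iN.
have se : 0 < s + e by rewrite addr_gt0.
rewrite (@nneseries_split _ _ 0 N) => [|i _]; last exact: diam_pow_ge0.
rewrite add0n eseries0 ?adde0; last by move=> i Ni _; rewrite VE // /diam_pow eqxx.
apply: (@le_trans _ _ (\sum_(0 <= i < N) (d `^ (s + e))%:E)%E).
  by apply: lee_sum => i _; have [VSi Vd] := VS i; exact: diam_pow_le.
rewrite sumEFin lee_fin sumr_const_nat subn0 -mulr_natr.
have dE : d `^ (s + e) = expR (s * ln d) * expR (e * ln d).
  by rewrite /powR gt_eqF // mulrDl expRD.
have E1 : expR (e * ln d) <= eta / 2.
  have h2 : 0 < eta / 2 by rewrite divr_gt0.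
  rewrite -[leRHS]lnK ?posrE // ler_expR -ler_pdivlMl // mulrC.
  by rewrite -(expRK (ln (eta / 2) / e)) ler_ln ?posrE ?expR_gt0 // ltW.
rewrite dE; have := expR_mulN (s * ln d).
rewrite mulrN in Nd; have := expR_gt0 (s * ln d); have := expR_gt0 (e * ln d).
move: (expR (s * ln d)) (expR (e * ln d)) (expR (- (s * ln d))) E1 Nd => a b c ba Nc b0 a0 ac.
have : a * N%:R <= 2 * (a * c) by rewrite mulrCA ler_pM2l // ltW.
rewrite ac => aN.
have : b * (a * N%:R) <= b * 2 by rewrite ler_pM2l //; lra.
lra.
Qed.

(** The factor [C] and the shift [c] add the bounded term [ln C + s * c] to the logarithm, which
    [e * - ln d] absorbs once [- ln d] exceeds the threshold [Q]. *)
Lemma upper_box_le A (V : R -> \bar R) (h : \bar R) (C c d0 : R) : 0 < C -> 0 < d0 ->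
  (limf_esup (fun r : R => (r^-1)%:E * lne (V r))%E (pinfty_nbhs R) <= h)%E ->
  (forall delta, 0 < delta < d0 -> (covering_number delta A <= C%:E * V (- ln delta + c)%R)%E) ->
  (upper_box_dim A <= h)%E.
Proof.
move=> C0 d00 Vh cov; apply: lee_by_reals => s e hs e0.
have [W [M [Mr MW]] WV] := limf_esup_lt (le_lt_trans Vh hs).
pose M' := Num.max M 0.
pose Q := `|ln C + s * c| / e.
pose d1 := Num.min (Num.min d0 1) (Num.min (expR (- (M' - c))) (expR (- Q))).
have d1_gt0 : 0 < d1 by rewrite !lt_min d00 ltr01 !expR_gt0.
apply: (limf_esup_le (near_right0 d1_gt0)) => d /= /andP[d_0].
rewrite !lt_min => /andP[/andP[dd0 d_1] /andP[dM dQ]].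
have ld : 0 < - ln d by rewrite oppr_gt0 ln_lt0 // d_0.
have lM : M' < - ln d + c.
  have : ln d < - (M' - c) by rewrite -(expRK (- (M' - c))) ltr_ln ?posrE ?expR_gt0.
  lra.
have lQ : Q < - ln d.
  have : ln d < - Q by rewrite -(expRK (- Q)) ltr_ln ?posrE ?expR_gt0.
  lra.
have [rM r0] : M < - ln d + c /\ 0 < - ln d + c.
  by split; apply: le_lt_trans lM; rewrite le_max lexx ?orbT.
have := WV _ (MW _ rM); rewrite /= muleC lee_pdivrMr // -EFinM lne_le => Vle.
rewrite /box_ratio lee_pdivrMr // -EFinM lne_le.
apply: le_trans (cov d _) _; first by rewrite d_0.
apply: (@le_trans _ _ (C%:E * (expR (s * (- ln d + c)))%:E)%E).
  by rewrite lee_pmul2l // lte_fin.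
rewrite -EFinM lee_fin -{1}(lnK C0) -expRD ler_expR.
have : Q * e = `|ln C + s * c| by rewrite /Q divfK // gt_eqF.
have := ler_norm (ln C + s * c).
move: (ln d) ld lQ => l ld lQ h1 h2.
nra.
Qed.

Lemma growth_rate_le (V : R -> \bar R) (h : R) :
  (forall s, h < s -> exists2 K, 0 < K & forall r, 0 < r -> (V r <= (K * expR (s * r))%:E)%E) ->
  (limf_esup (fun r : R => (r^-1)%:E * lne (V r))%E (pinfty_nbhs R) <= h%:E)%E.
Proof.
move=> H; apply: lee_by_reals => s e; rewrite lte_fin => hs e0.
have [K K0 VK] := H s hs.
pose M := Num.max 0 (ln K / e).
apply: (@limf_esup_le _ _ _ _ _ [set r | M < r]).
  by exists M; split => //; exact: num_real.
move=> r /=; rewrite gt_max => /andP[r0 rK].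
rewrite muleC lee_pdivrMr // -EFinM lne_le; apply: le_trans (VK r r0) _.
rewrite lee_fin -{1}(lnK K0) -expRD ler_expR.
by move: rK; rewrite ltr_pdivrMr //; lra.
Qed.

End Dimensions.

(** * The convex core *)

Section CoreVolume.
Context {R : realType} {n : nat}.
Local Notation k := n.+1.
Implicit Types (x y z xi : 'rV[R]_k) (X Lambda : set 'rV[R]_k).

Lemma critical_exponent_growth X z (m s : R) : X `<=` unit_ball -> unit_ball z -> 0 < m ->
  uniformly_separated X m -> critical_exponent X z < s ->
  exists2 K, 0 <= K & forall r, 0 < r -> finite_set (X `&` hball z r) /\
    (cnt (X `&` hball z r))%:R <= K * expR (s * r).
Proof.
move=> XB zb m0 sX cs.
have [K0 K00 g0] := separated_growth XB zb m0 sX.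
have k1 : (k%:R : R) < k%:R + 1 by rewrite ltrDl.
have [s' [s'0 s'fin] s's] : exists2 s', [set s : R | 0 < s /\
    (\esum_(x in X) (expR (- (s * hdist x z)))%:E < +oo)%E] s' & s' < s.
  (* The set of admissible exponents is nonempty, by the crude growth bound with exponent [k]; it
     therefore has an element below [s]. *)
  apply: inf_lt cs; exists (k%:R + 1); split; first by rewrite addr_gt0 // ltr0n.
  exact: growth_esum XB zb K00 (ler0n _ _) k1 g0.
have [K KK g] := esum_growth XB zb (ltW s'0) s'fin.
exists K => // r r0; have finX := growth_finite r g; split => //.
apply: (@le_trans _ _ (K * expR (s' * r))).
  apply: g; first exact: fset_uniq.
  by move=> x; rewrite in_fset_set // => /set_mem.
by rewrite ler_wpM2l // ler_expR ler_wpM2r // ltW.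
Qed.

Lemma core_volume_le Lambda X z (eps s : R) : Lambda `<=` unit_sphere ->
  uniformly_distributed (hhull Lambda) X -> unit_ball z -> 0 < eps ->
  critical_exponent X z < s -> exists2 K : R, 0 < K & forall r : R, 0 < r ->
    (hvol (hball z r `&` hneighborhood (hhull Lambda) eps) <= (K * expR (s * r))%:E)%E.
Proof.
move=> LS [XH [M XM] [m m0 sX]] zb eps0 cs.
have XB : X `<=` unit_ball by move=> x /XH; exact: hull_ball.
have [K K0 HK] := critical_exponent_growth XB zb m0 sX cs.
(* Every point of the neighbourhood is within [D] of [X]; the maximum keeps [D] positive whatever
   the sign of [M]. *)
pose D := Num.max 0 M + eps.
have D0 : 0 < D by rewrite /D ltr_wpDl // le_max lexx.
have [C C0 HC] := @hvol_covering R n D (ltW D0).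
have P0 : 0 <= C * (K * expR (s * D)).
  by rewrite mulr_ge0 ?(ltW C0) // mulr_ge0 // expR_ge0.
exists (C * (K * expR (s * D)) + 1) => [|r r0]; first by rewrite ltr_wpDl.
have [finX NX] := HK (r + D) (addr_gt0 r0 D0).
apply: le_trans (HC (fset_set (X `&` hball z (r + D))) _ _ _) _.
- by move=> y [[]].
- move=> y [[yb yz] [_ [h Hh yh]]]; have [x Xx xh] := XM h Hh.
  have hb := hull_ball LS Hh; have xb := XB _ Xx; exists x.
  have xy : hdist x y < D.
    have := hdist_triangle xb hb yb; rewrite (hdistC h y) /D.
    have : M <= Num.max 0 M by rewrite le_max lexx orbT.
    lra.
  split => //; last by rewrite hdistC ltW.
  rewrite in_fset_set // mem_set //; split => //; split => //.
  by have := hdist_triangle xb yb zb; lra.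
rewrite lee_fin mulrDl mul1r -mulrA -mulrA -expRD -mulrDr (addrC D).
apply: (@le_trans _ _ (C * (K * expR (s * (r + D))))); first by rewrite ler_pM2l.
by rewrite lerDl expR_ge0.
Qed.

(** Balls of radius at most [m / 2] about the points of [X] are disjoint; radius at most [eps] keeps
    them in the neighbourhood of the hull and in the enlarged ball. *)
Lemma core_volume_ge Lambda X z (eps m : R) : Lambda `<=` unit_sphere ->
  X `<=` hhull Lambda -> unit_ball z -> 0 < eps -> 0 < m -> uniformly_separated X m ->
  exists2 C : R, 0 < C & forall r : R,
    ((cnt (X `&` hball z r))%:R%:E <=
      C%:E * hvol (hball z (r + eps) `&` hneighborhood (hhull Lambda) eps))%E.
Proof.
move=> LS XH zb eps0 m0 sX.
have XB : X `<=` unit_ball by move=> x /XH; exact: hull_ball.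
pose q := Num.min (m / 2) eps.
have q0 : 0 < q by rewrite lt_min eps0 divr_gt0.
have qm : 2 * q <= m by have : q <= m / 2 by [rewrite ge_min lexx]; lra.
have qe : q <= eps by rewrite ge_min lexx orbT.
have [c c0 Hc] := @hvol_packing R n q q0.
exists c^-1 => [|r]; first by rewrite invr_gt0.
have [K K0 g] := separated_growth XB zb m0 sX.
have finX := growth_finite r g.
have tP x : x \in fset_set (X `&` hball z r) -> X x /\ hball z r x.
  by rewrite in_fset_set // => /set_mem.
rewrite muleC lee_pdivlMr // -EFinM mulrC.
apply: Hc; first exact: fset_uniq.
- by move=> x [[]].
- move=> x /tP[Xx [xb xz]]; split => // y [yb yx]; split; split => //.
    by have := hdist_triangle yb xb zb; lra.
  by exists x; [exact: XH|lra].
- move=> x y /tP[Xx _] /tP[Xy _] xy; apply: le_trans qm _.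
  by apply: sX => //; exact/eqP.
Qed.

(** The points at Euclidean height [p = 1 - a * delta] on the rays to [Lambda] are grouped by a
    point of [X] within [D]. Two points of one group are within [2 * D], and [a] is so small that
    the ends of their rays are then within [delta]. *)
Lemma covering_number_le Lambda X z : Lambda `<=` unit_sphere ->
  uniformly_distributed (hhull Lambda) X -> X !=set0 -> unit_ball z ->
  exists c : R, forall delta : R, 0 < delta < 1 ->
    (covering_number delta Lambda <= (cnt (X `&` hball z (- ln delta + c)))%:R%:E)%E.
Proof.
move=> LS XU X0 zb; have [XH _ [m m0 sX]] := XU.
have XB : X `<=` unit_ball by move=> x /XH; exact: hull_ball.
have [D D0 near] := uniformly_distributed_near_rays LS XU X0.
have [K K0 g] := separated_growth XB zb m0 sX.
have z0 := @unit_ball0 R n.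
set C := cosh (2 * D).
have C1 : 1 <= C by exact: cosh_ge1.
pose a := (8 * C)^-1.
have aC : a * C = 8^-1 by rewrite /a; field; rewrite gt_eqF //; lra.
have a0 : 0 < a by rewrite invr_gt0; lra.
have a8 : a <= 8^-1 by nra.
(* The distance from the origin to [p *: xi] is at most [ln (2 / a) - ln delta]; then come the step
   [D] to [X], the change of base point to [z], and [1] for a strict inequality. *)
exists (D + ln (2 / a) + hdist 0 z + 1) => delta /andP[d0 d1].
set r := - ln delta + _.
have ad0 : 0 < a * delta by rewrite mulr_gt0.
have ad8 : a * delta <= 8^-1 by nra.
set p := 1 - a * delta.
have p01 : 0 <= p < 1 by apply/andP; rewrite /p; split; lra.
have finX := growth_finite r g.
set t := fset_set (X `&` hball z r) : seq _.
apply: ereal_inf_lbound; exists (cnt (X `&` hball z r)) => //.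
exists (fun i => [set xi | Lambda xi /\ hdist (nth 0 t i) (p *: xi) <= D]); split.
- move=> i; split; first by move=> xi [/LS].
  have tb : unit_ball (nth 0 t i).
    (* Beyond the list [nth] returns the default [0], which is in the ball, so the diameter bound
       holds for every index. *)
    have [it|it] := ltnP i (size t); last by rewrite nth_default.
    by have := mem_nth 0 it; rewrite in_fset_set // => /set_mem[/XB].
  apply: ge_ereal_sup => _ [[xi eta] [/= [Lxi xiD] [Leta etaD]] <-] /=; rewrite lee_fin.
  have xib := ray_ball (LS _ Lxi) p01; have etab := ray_ball (LS _ Leta) p01.
  have : hdist (p *: xi) (p *: eta) <= 2 * D.
    by have := hdist_triangle xib tb etab; rewrite (hdistC (p *: xi) (nth 0 t i)); lra.
  rewrite hdist_le //; last by rewrite mulr_ge0.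
  rewrite -/C /ch -scalerBr !sqnormZ (LS _ Lxi) (LS _ Leta) !mulr1 -lerBrDl => h.
  have w0 : 0 < 1 - p ^+ 2 by rewrite /p; nra.
  rewrite ler_pdivrMr ?mulr_gt0 // in h.
  have e4 : enorm (xi - eta) <= delta / 2.
    rewrite enorm_le; last by rewrite divr_ge0 // ltW.
    have w2 : 1 - p ^+ 2 <= 2 * (a * delta) by rewrite /p; nra.
    have ww : (1 - p ^+ 2) * (1 - p ^+ 2) <= (2 * (a * delta)) * (2 * (a * delta)).
      by apply: ler_pM => //; exact: ltW.
    have p2 : 2^-1 <= p ^+ 2 by rewrite /p; nra.
    have s0 := sqnorm_ge0 (xi - eta).
    have h1 : sqnorm (xi - eta) <= 2 * (p ^+ 2 * sqnorm (xi - eta)) by nra.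
    have h2 : (C - 1) * ((1 - p ^+ 2) * (1 - p ^+ 2)) <= C * (2 * (a * delta) * (2 * (a * delta))).
      apply: ler_pM => //; [lra|by rewrite mulr_ge0 // ltW|lra].
    have h3 : C * (2 * (a * delta) * (2 * (a * delta))) = 4 * (a * C) * a * delta ^+ 2 by ring.
    rewrite h3 aC in h2.
    have d2 : 0 <= delta ^+ 2 by exact: sqr_ge0.
    have -> : (delta / 2) ^+ 2 = delta ^+ 2 / 4 by field.
    nra.
  apply: (le_trans (sdist_le_enorm (LS _ Lxi) (LS _ Leta) _)); lra.
- move=> xi Lxi; have [x Xx xD] := near xi p Lxi p01.
  have xib := ray_ball (LS _ Lxi) p01; have xb := XB _ Xx.
  have xt : x \in t.
    rewrite in_fset_set // mem_set //; split => //; split => //.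
    have := hdist_triangle xb xib zb; have := hdist_triangle xib z0 zb.
    have [_ ch0] := ch0_bounds xib.
    have ep : enorm (p *: xi) = p.
      by rewrite enormZ /enorm (LS _ Lxi) sqrtr1 mulr1 ger0_norm //; case/andP: p01.
    have p1E : 1 - p = a * delta by rewrite /p; ring.
    have := hdist_le_ln xib z0 ch0; rewrite ep p1E.
    have -> : 2 / (a * delta) = 2 / a * delta^-1.
      by field; rewrite !gt_eqF.
    rewrite lnM ?posrE ?invr_gt0 ?divr_gt0 // lnV ?posrE // /r; lra.
  exists (index x t); first by rewrite /= /cnt index_mem.
  by split => //; rewrite nth_index.
Qed.

End CoreVolume.

(** * Closing the chain of inequalities *)

Theorem theorem7 (R : realType) (n : nat) (n_ge1 : (1 <= n)%N)
    (Lambda : set 'rV[R]_n.+1)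
    (Lambda_sphere : Lambda `<=` unit_sphere) (Lambda_closed : closed Lambda)
    (X : set 'rV[R]_n.+1)
    (X_unif : uniformly_distributed (hhull Lambda) X)
    (X_bdd : bounded_type X)
    (z : 'rV[R]_n.+1) (z_ball : unit_ball z) (eps : R) (eps_gt0 : 0 < eps) :
  (0 < hausdorff_measure (critical_exponent X z) Lambda)%E /\
  lower_box_dim Lambda = upper_box_dim Lambda /\
  hausdorff_dim Lambda = convex_core_entropy Lambda z eps /\
  convex_core_entropy Lambda z eps = upper_box_dim Lambda.
Proof.
have X0 : X !=set0 by case: X_bdd => x0 Xx0 _; exists x0.
have [XH _ [m m0 sX]] := X_unif.
have L0 : Lambda !=set0.
  have [x Xx] := X0.
  have [u [v [Lu _ _]]] := hull_two_points Lambda_sphere (ex_intro _ x (XH _ Xx)).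
  by exists u.
have D0 : 0 <= critical_exponent X z.
  rewrite /critical_exponent; set S := [set _ | _].
  have [->|/set0P S0] := eqVneq S set0; first by rewrite inf0.
  by apply: lb_le_inf => // s [/ltW].
have pos : (0 < hausdorff_measure (critical_exponent X z) Lambda)%E.
  (* The renewal argument lowers a positive exponent; for exponent [0] the claim reduces to [Lambda]
     being nonempty. *)
  move: D0; rewrite le_eqVlt => /predU1P[<-|D0]; first exact: hausdorff_measure_gt0_nonempty.
  have [c [r0 [c0 r00 H]]] :=
    finite_cover_bound Lambda_sphere X_unif X_bdd z_ball (ler0n _ n.+1) D0.
  exact: hausdorff_measure_gt0 Lambda_sphere Lambda_closed D0 c0 r00 H.
have D_dimH := hausdorff_dim_ge pos.
have dimH_lbox := hausdorff_dim_le_lower_box L0.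
have lbox_ubox : (lower_box_dim Lambda <= upper_box_dim Lambda)%E.
  exact: limf_einf_le_esup.
have hc_D : (convex_core_entropy Lambda z eps <= (critical_exponent X z)%:E)%E.
  by apply: growth_rate_le => s hs; exact: (core_volume_le Lambda_sphere X_unif).
have ubox_hc : (upper_box_dim Lambda <= convex_core_entropy Lambda z eps)%E.
  have [C C0 HC] := core_volume_ge Lambda_sphere XH z_ball eps_gt0 m0 sX.
  have [c Hc] := covering_number_le Lambda_sphere X_unif X0 z_ball.
  apply: (@upper_box_le _ _ _ (fun r => hvol (hball z r `&` hneighborhood (hhull Lambda) eps))
    _ C (c + eps) 1) => // delta d01.
  by rewrite addrA; apply: le_trans (Hc _ d01) (HC _).
have le1 := le_trans hc_D D_dimH.
have le2 := le_trans dimH_lbox lbox_ubox.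
split; first exact: pos.
split; first by apply/eqP; rewrite eq_le lbox_ubox (le_trans ubox_hc (le_trans le1 dimH_lbox)).
split; apply/eqP; rewrite eq_le; apply/andP; split => //.
  exact: le_trans le2 ubox_hc.
exact: le_trans le1 le2.
Qed.
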